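(* Let $G$ be a finite nonzero abelian group. Then $\mathcal A(G)$ is a minimal set with respect to the Davenport constant ${\rm D}(G)$ if and only if one of the following conditions holds: (i) $G\cong \mathbb Z_2^r$ with $r\geq 1$; (ii) $G\cong \mathbb Z_3^r$ with $1\le r\leq 4$; (iii) $G\cong \mathbb Z_4$ or $G\cong \mathbb Z_5$.
   Context: $\mathbb Z_m$ denotes the cyclic group of order $m$. For an abelian group $G$, $\mathcal F(G)$ is the free commutative monoid with basis $G$ (written multiplicatively); its elements are called sequences over $G$, i.e. finite unordered sequences (multisets) of elements of $G$ with repetition allowed. The length $|T|$ of a sequence is the number of its terms counted with multiplicity, $\sigma(T)$ is the sum of its terms, and $T'$ is a subsequence of $T$ if $T'$ divides $T$ in $\mathcal F(G)$ (sub-multiset). A sequence $T$ is zero-sum if $\sigma(T)=0$; it is a minimal zero-sum sequence if it is nonempty, zero-sum, and has no nonempty proper (i.e. $\neq T$) zero-sum subsequence. $\mathcal B(G)$ is the set of all zero-sum sequences over $G$, and $\mathcal A(G)$ is the set of all minimal zero-sum sequences over $G$. The Davenport constant ${\rm D}(G)$ of a finite abelian group $G$ is the least positive integer $\ell$ such that every sequence over $G$ of length $\ell$ has a nonempty zero-sum subsequence. For a subset $\Omega\subset\mathcal F(G)$, ${\mathsf d}_\Omega(G)$ is the least positive integer $\ell$ such that every sequence over $G$ of length $\ell$ has a subsequence lying in $\Omega$ (and ${\mathsf d}_\Omega(G)=\infty$ if no such $\ell$ exists). One has ${\mathsf d}_{\mathcal A(G)}(G)={\rm D}(G)$. A set $\Omega\subset\mathcal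 B(G)$ is called minimal with respect to ${\rm D}(G)$ if ${\mathsf d}_\Omega(G)={\rm D}(G)$ and ${\mathsf d}_{\Omega'}(G)\neq {\rm D}(G)$ for every proper subset $\Omega'\subsetneq\Omega$. *)

(* Defs.v *)
From HB Require Import structures.
From mathcomp Require Import all_boot all_order all_algebra all_fingroup cyclic.
From mathcomp Require Import finmap multiset.
From mathcomp Require Import boolp classical_sets.

Set Implicit Arguments.
Unset Strict Implicit.
Unset Printing Implicit Defensive.

Local Open Scope mset_scope.

(* [Some l] with l the least positive integer satisfying P; [None] stands for
   infinity, i.e. no positive integer satisfies P. *)
Definition least_positive (P : nat -> Prop) : option nat :=
  match pselect (exists l, `[< 0 < l /\ P l >]) with
  | left exP => Some (ex_minn exP)
  | right _ => None
  end.

Section ZeroSum.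

Variable G : finZmodType.

Definition msum (T : {mset G}) : G := (\sum_(g <- T) g)%R.

Definition zero_sum (T : {mset G}) : Prop := msum T = 0%R.

Definition minimal_zero_sum (T : {mset G}) : Prop :=
  [/\ T <> mset0, zero_sum T
    & forall T' : {mset G}, T' `<` T -> T' <> mset0 -> ~ zero_sum T'].

Definition zero_sum_sequences : set {mset G} := [set T | zero_sum T]%classic.

Definition minimal_zero_sum_sequences : set {mset G} :=
  [set T | minimal_zero_sum T]%classic.

Definition davenport : option nat :=
  least_positive (fun l => forall S : {mset G}, size S = l ->
    exists T : {mset G}, [/\ T `<=` S, T <> mset0 & zero_sum T]).

Definition d_Omega (Omega : set {mset G}) : option nat :=
  least_positive (fun l => forall S : {mset G}, size S = l ->
    exists T : {mset G}, T `<=` S /\ Omega T).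

Definition minimal_wrt_davenport (Omega : set {mset G}) : Prop :=
  [/\ (Omega `<=` zero_sum_sequences)%classic,
      d_Omega Omega = davenport
    & forall Omega' : set {mset G},
        (Omega' `<` Omega)%classic -> d_Omega Omega' <> davenport].

End ZeroSum.

Arguments zero_sum_sequences G : clear implicits.
Arguments minimal_zero_sum_sequences G : clear implicits.
Arguments davenport G : clear implicits.

Lemma least_positiveP (P : nat -> Prop) (l : nat) :
  least_positive P = Some l <->
  [/\ 0 < l, P l & forall k, 0 < k -> P k -> l <= k].
Proof.
rewrite /least_positive; case: pselect => [exP|nP].
  case: ex_minnP => m /asboolP [m0 Pm] mmin; split.
    by case=> <-; split=> // k k0 Pk; apply: mmin; apply/asboolP.
  case=> l0 Pl lmin; congr Some; apply/eqP; rewrite eqn_leq lmin // andbT.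
  by apply: mmin; apply/asboolP.
split=> // -[l0 Pl _]; case: nP; exists l; exact/asboolP.
Qed.

Lemma davenport_finite (G : finZmodType) : davenport G <> None.
Proof.
rewrite /davenport /least_positive; case: pselect => // nP _; apply: nP.
exists (#|G| * #|G|).+1; apply/asboolP; split=> // S sS.
have G0 : 0 < #|G| by apply/card_gt0P; exists 0%R.
have [g Sg] : exists g, #|G| <= S g.
  apply/existsP; apply: contraT; rewrite negb_exists => /forallP H.
  have : size S <= #|G| * #|G|.
    rewrite size_mset (@leq_trans (\sum_(a <- finsupp S) #|G|)) //.
      by apply: leq_sum => a _; apply: ltnW; rewrite ltnNge.
    rewrite big_const_seq count_predT iter_addn_0 mulnC leq_mul2r.
    by rewrite -(card_uniqP (fset_uniq (finsupp S))) max_card orbT.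
  by rewrite sS ltnn.
exists (msetn #|G| g); split.
- by apply/msubsetP => x; rewrite msetnE; case: eqP => [->|].
- by move/msetP/(_ g); rewrite msetnxx mset0E => E; rewrite E in G0.
- rewrite /zero_sum /msum big_msetn /= Monoid.iteropE.
  have := order_dvdG (finset.in_setT g).
  rewrite cardsT order_dvdn FinRing.zmodXgE => /eqP gG.
  by rewrite -[RHS]gG -Algebra.iter_addr_0.
Qed.

(* Main.v *)
(* The set A(G) is minimal if and only if every minimal zero-sum sequence t is the
   only minimal zero-sum subsequence of some sequence s of length D(G).

   Obstructions.  The terms of s outside t, put together with a zero-sum free w all
   of whose subsums are subsums of t, form a zero-sum free sequence, so more than |w|
   terms of s belong to t.  A well chosen t violates this if G has an element of
   order n >= 6, or contains Z_4 + Z_2, Z_5^2 or Z_3^5; every other group is on the list.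

   Existence for Z_3^r with r <= 4.  Double the terms of t indexed by a maximal set K
   such that t stays the only relation, and add a doubled basis of a complement of the
   span.  Counting lengths, one needs |J| < 2m where J is the complement of K and m is
   the dimension of the relation code of t.  The columns in J of a generator matrix of
   this code, normalised to coordinate sum 1, form a minimal blocking set for the
   hyperplanes of the affine space AG(m-1,3), and |J| <= m + 4.  For such sizes a finite
   search shows that minimal blocking sets have at most 2m - 1 points (in AG(3,3)
   there is one with 9 points, which is why r = 5 fails).  The upper bound
   D(Z_p^r) <= r(p-1) + 1 holds because the indicator function of 0 is a polynomial
   of degree r(p-1), while taking differences along a zero-sum free sequence does not
   kill its value at 0. *)

Require Import Defs.
From mathcomp Require Import all_boot all_order all_algebra all_fingroup.
From mathcomp Require Import finmap multiset.
From mathcomp Require Import boolp classical_sets.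
From mathcomp Require Import cyclic abelian pgroup finfield.
From mathcomp Require Import zify.
Import GRing.Theory.

Set Implicit Arguments.
Unset Strict Implicit.
Unset Printing Implicit Defensive.

(** * Sequences as lists *)

Section Submultisets.

Variable T : eqType.
Implicit Types s t u : seq T.

(** Divisibility in the free commutative monoid, for lists read as multisets; up to reordering it is
    [subseq]. *)
Definition submset u s := forall x, count_mem x u <= count_mem x s.

Lemma submset_subseq u s : subseq u s -> submset u s.
Proof. by move=> us x; apply: leq_count_subseq. Qed.

Lemma submset_ex u s : submset u s -> exists2 v, subseq v s & perm_eq v u.
Proof.
by move=> us; have /count_subseqP[v vs uv] := us; exists v; rewrite 1?perm_sym.
Qed.

Lemma submset_trans s u t : submset u s -> submset s t -> submset u t.
Proof. by move=> us st x; apply: leq_trans (us x) (st x). Qed.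

Lemma perm_submset u s : perm_eq u s -> submset u s.
Proof. by move=> /seq.permP us x; rewrite us. Qed.

Lemma submset_size u s : submset u s -> size u <= size s.
Proof.
by case/submset_ex => v vs /perm_size <-; apply: size_subseq.
Qed.

Lemma subseq_cat_ex u s1 s2 : subseq u (s1 ++ s2) ->
  exists u1 u2, [/\ u = u1 ++ u2, subseq u1 s1 & subseq u2 s2].
Proof.
case/subseqP=> m szm ->; exists (mask (take (size s1) m) s1).
exists (mask (drop (size s1) m) s2).
split; rewrite ?mask_subseq // -mask_cat ?cat_take_drop //.
by rewrite size_takel // szm size_cat leq_addr.
Qed.

Lemma size_subseq_eq u s : subseq u s -> size s <= size u -> u = s.
Proof.
move=> us su; apply/eqP; have [_] := size_subseq_leqif us.
by rewrite eqn_leq su (size_subseq us) => <-.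
Qed.

End Submultisets.

Lemma subseq_map_ex (T U : eqType) (f : T -> U) u s : subseq u (map f s) ->
  exists2 v, subseq v s & u = map f v.
Proof.
case/subseqP=> m _ ->; exists (mask m s); first exact: mask_subseq.
by rewrite map_mask.
Qed.

Local Open Scope ring_scope.

Section ZeroSumLists.

Variable G : zmodType.
Implicit Types s t u : seq G.

Definition zsfree s :=
  forall u, subseq u s -> \sum_(x <- u) x = 0 -> u = [::].

Definition mzs t := [/\ t <> [::], \sum_(x <- t) x = 0
  & forall u, subseq u t -> \sum_(x <- u) x = 0 -> u = [::] \/ u = t].

(** The occurrence of [t] in [s] is left to follow from the length of [s]: with D(G) terms, [s] has
    some minimal zero-sum subsequence, which can only be [t]. *)
Definition only_mzs t s :=
  forall u, submset u s -> mzs u -> perm_eq u t.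

Lemma sum_perm u t : perm_eq u t -> \sum_(x <- u) x = \sum_(x <- t) x.
Proof. exact: perm_big. Qed.

Lemma zsfree_submset s u :
  zsfree s -> submset u s -> \sum_(x <- u) x = 0 -> u = [::].
Proof.
move=> sP /submset_ex[v vs vu] u0; apply/nilP; rewrite /nilp -(perm_size vu).
by rewrite (sP v) // (sum_perm vu).
Qed.

Lemma mzs_ex s : s <> [::] -> \sum_(x <- s) x = 0 ->
  exists2 t, subseq t s & mzs t.
Proof.
have [n] := ubnP (size s); elim: n s => // n IHn s; rewrite ltnS => sn s0 ss.
have [[u [us su u0 uns]]|noex] := pselect (exists u,
    [/\ subseq u s, \sum_(x <- u) x = 0, u <> [::] & u <> s]).
  have [|//|//|t tu tP] := IHn u.
    apply: leq_trans sn; rewrite ltnNge; apply/negP => /(size_subseq_eq us).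
    exact: uns.
  by exists t => //; apply: subseq_trans us.
exists s => //; split=> // u us su; have [->|/eqP uns] := eqVneq u s; first by right.
left; have [//|/eqP u0] := eqVneq u [::].
by case: noex; exists u.
Qed.

End ZeroSumLists.

(** * Minimality of A(G) in terms of lists *)

Section Reformulation.

Local Open Scope mset_scope.

Variable G : finZmodType.
Implicit Types s t u : seq G.

Lemma msumE (T : {mset G}) : msum T = \sum_(x <- (T : seq G)) x.
Proof. by []. Qed.

Lemma msum_seq s : msum (seq_mset s) = \sum_(x <- s) x.
Proof. by rewrite msumE; apply: sum_perm; apply: perm_eq_seq_mset. Qed.

Lemma seq_mset0 s : (seq_mset s = mset0) <-> s = [::].
Proof.
split=> [/msetP s0|->]; last by apply/msetP => x; rewrite mset_seqE mset0E.
case: s s0 => // x s /(_ x); rewrite mset_seqE mset0E /= eqxx.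
by [].
Qed.

Lemma sub_seq_mset u s : (seq_mset u `<=` seq_mset s)%mset <-> submset u s.
Proof.
split=> [/msubsetP us x|us]; first by rewrite -!mset_seqE.
by apply/msubsetP => x; rewrite !mset_seqE.
Qed.

Lemma mzsE t : minimal_zero_sum (seq_mset t) <-> mzs t.
Proof.
split=> [[t0 st tP]|[t0 st tP]]; split.
- by move/seq_mset0.
- by rewrite -msum_seq.
- move=> u ut su; have [->|/eqP unt] := eqVneq u t; first by right.
  left; have [//|/eqP u0] := eqVneq u [::].
  exfalso; apply: (tP (seq_mset u)); last by rewrite /zero_sum msum_seq.
    rewrite /mproper; apply/andP; split.
      exact/sub_seq_mset/submset_subseq.
    apply/negP => /sub_seq_mset/submset_size tu; apply: unt.
    exact: size_subseq_eq.
  by move/seq_mset0.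
- by move/seq_mset0.
- by rewrite /zero_sum msum_seq.
move=> M; rewrite -[M]seq_mset_id => Mt M0 sM.
move: Mt; rewrite /mproper => /andP[/sub_seq_mset Mt /negP]; apply.
apply/sub_seq_mset/perm_submset.
have [v vt vM] := submset_ex Mt.
have [|v0|<-] := tP v vt; last by [].
  by rewrite (sum_perm vM) -msum_seq.
exfalso; apply: M0; apply/seq_mset0/nilP; rewrite /nilp -(perm_size vM).
by rewrite v0.
Qed.

Lemma size_seq_mset s : size (seq_mset s) = size s.
Proof. exact/perm_size/perm_eq_seq_mset. Qed.

Lemma davenportP d : davenport G = Some d <->
  [/\ (0 < d)%N, forall s, size s = d -> ~ zsfree s
    & exists2 s : seq G, size s = d.-1 & zsfree s].
Proof.
have E l : (forall S : {mset G}, size S = l -> exists T : {mset G},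
      [/\ (T `<=` S)%mset, T <> mset0 & zero_sum T]) <->
    (forall s : seq G, size s = l -> ~ zsfree s).
  split=> [H s sl sP|H S Sl].
    have [|T [TS T0 sT]] := H (seq_mset s); first by rewrite size_seq_mset.
    apply: T0; rewrite -[T]seq_mset_id; apply/seq_mset0.
    apply: (zsfree_submset sP) => //; apply/sub_seq_mset.
    by rewrite seq_mset_id.
  apply: contrapT => noT; apply: (H S Sl) => u uS su.
  apply: contrapT => u0; apply: noT; exists (seq_mset u); split.
  - by rewrite -[S]seq_mset_id; apply/sub_seq_mset/submset_subseq.
  - by move/seq_mset0.
  - by rewrite /zero_sum msum_seq.
rewrite /davenport least_positiveP; split.
  case=> d0 /E dP dmin; split=> //; case: d d0 dP dmin => // -[|d] _ dP dmin.
    by exists [::] => // u; rewrite subseq0 => /eqP.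
  apply: contrapT => noex; have /(dmin _ (ltn0Sn d)) : forall S : {mset G},
      size S = d.+1 -> exists T : {mset G},
      [/\ (T `<=` S)%mset, T <> mset0 & zero_sum T].
    by apply/E => s sd sP; apply: noex; exists s.
  by rewrite ltnn.
case=> d0 dP [s sd sP]; split=> //; first exact/E.
move=> k k0 /E kP; rewrite leqNgt; apply/negP => kd.
have ks : (k <= size s)%N by rewrite sd -ltnS prednK.
apply: (kP (take k s)); first by rewrite size_takel.
by move=> u us; apply: sP; apply: subseq_trans us (take_subseq _ _).
Qed.

Lemma davenport_le d s : davenport G = Some d -> (d <= size s)%N -> ~ zsfree s.
Proof.
case/davenportP => _ dP _ ds sP; apply: (dP (take d s)); first by rewrite size_takel.
by move=> u us; apply: sP; apply: subseq_trans us (take_subseq _ _).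
Qed.

(** The constant can only grow when elements of A(G) are removed, so it is enough to remove a single
    [t]. The constant then stays D(G) unless some [s] of length D(G) has [t] as its only minimal
    zero-sum subsequence. *)
Lemma minimal_davenportP :
  minimal_wrt_davenport (minimal_zero_sum_sequences G) <->
  forall t, mzs t -> exists2 s, davenport G = Some (size s) & only_mzs t s.
Proof.
have [d dG] : exists d, davenport G = Some d.
  by case: (davenport G) (@davenport_finite G) => // d _; exists d.
have [d0 dle [w wd wP]] := (davenportP d).1 dG.
(* A zero-sum free sequence of length D(G) - 1 has no subsequence in A(G), so no subset of A(G) has
   a constant below D(G). *)
have dmin k (Om : set {mset G}) : (0 < k)%N ->
    (Om `<=` minimal_zero_sum_sequences G)%classic ->
    (forall S : {mset G}, size S = k -> exists T, (T `<=` S)%mset /\ Om T) ->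
    (d <= k)%N.
  move=> k0 OmA kP; rewrite leqNgt; apply/negP => kd.
  have ks : (k <= size w)%N by rewrite wd -ltnS prednK.
  have [|T []] := kP (seq_mset (take k w)).
    by rewrite size_seq_mset size_takel.
  rewrite -[T]seq_mset_id => /sub_seq_mset Tw /OmA /mzsE[T0 sT _]; apply: T0.
  apply: (zsfree_submset wP) => //; apply: submset_trans Tw _.
  exact/submset_subseq/take_subseq.
rewrite /minimal_wrt_davenport dG; split.
  case=> _ _ minA t tP; apply: contrapT => noS.
  pose Om := [set T : {mset G} | minimal_zero_sum T /\ T <> seq_mset t]%classic.
  apply: (minA Om).
    rewrite properEneq; split; last by move=> T [].
    apply/eqP => /(congr1 (fun P => P (seq_mset t))) E.
    have : minimal_zero_sum_sequences G (seq_mset t) by apply/mzsE.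
    by rewrite -E => -[].
  rewrite /d_Omega least_positiveP; split=> //; last first.
    by move=> k k0 kP; apply: (dmin k Om) => // T [].
  move=> S Sd; apply: contrapT => noT; apply: noS; exists (S : seq G).
    by rewrite Sd.
  move=> u uS uP; apply: contrapT => ut; apply: noT; exists (seq_mset u).
  split; first by rewrite -[S]seq_mset_id; apply/sub_seq_mset.
  split; first exact/mzsE.
  by move/eq_seq_msetP.
move=> allT; split.
- by move=> T [].
- rewrite /d_Omega least_positiveP; split=> //; last first.
    by move=> k k0 kP; apply: (dmin k (minimal_zero_sum_sequences G)).
  move=> S Sd; have SP := dle S Sd.
  have [u [uS su u0]] : exists u,
      [/\ subseq u S, \sum_(x <- u) x = 0 & u <> [::]].
    apply: contrapT => nou; apply: SP => u uS su; apply: contrapT => u0.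
    by apply: nou; exists u.
  have [t tu tP] := mzs_ex u0 su; exists (seq_mset t); split.
    rewrite -[S]seq_mset_id; apply/sub_seq_mset/submset_subseq.
    exact: subseq_trans uS.
  exact/mzsE.
move=> Om [OmA AnOm] dOm.
have [T [TA TOm]] : exists T, minimal_zero_sum T /\ ~ Om T.
  apply: contrapT => noT; apply: AnOm => T TA; apply: contrapT => TOm.
  by apply: noT; exists T.
rewrite -[T]seq_mset_id in TA TOm.
have [s] := allT _ ((mzsE _).1 TA) => -[ds] sP.
case/least_positiveP: dOm => _ /(_ (seq_mset s)) + _.
rewrite size_seq_mset => /(_ (esym ds)) [M []].
rewrite -[M]seq_mset_id => /sub_seq_mset Ms OmM; apply: TOm.
have /(sP _ Ms)/eq_seq_msetP <- // : mzs M by apply/mzsE/OmA.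
Qed.

End Reformulation.

(** * Sufficient conditions for minimality *)

(** The length of [s] is only bounded from below, since the property of [s] passes to initial
    segments. It concerns all nonempty zero-sum subsequences, minimal or not. *)
Definition zs_extendable (G : zmodType) d := forall t : seq G, mzs t ->
  exists2 s, (d <= size s)%N &
    forall u, subseq u s -> \sum_(x <- u) x = 0 -> u = [::] \/ perm_eq u t.

Definition zs_bounded (G : zmodType) d :=
  forall s : seq G, size s = d -> ~ zsfree s.

(** Boundedness gives D(G) <= [d], so the extension of [t] can be cut down to exactly D(G) terms. *)
Lemma minimal_davenport (G : finZmodType) d : (0 < d)%N ->
  zs_bounded G d -> zs_extendable G d ->
  minimal_wrt_davenport (minimal_zero_sum_sequences G).
Proof.
move=> d0 dB dE; apply/minimal_davenportP => t /dE[s ds sP].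
have [k kG] : exists k, davenport G = Some k.
  by case: (davenport G) (@davenport_finite G) => // k _; exists k.
have kd : (k <= d)%N.
  have [_ _ [w wk wP]] := (davenportP G k).1 kG.
  rewrite leqNgt; apply/negP => dk.
  have dw : (d <= size w)%N by rewrite wk -ltnS (ltn_predK dk).
  apply: (dB (take d w)); first by rewrite size_takel.
  by move=> u us; apply: wP; apply: subseq_trans us (take_subseq _ _).
exists (take k s); first by rewrite size_takel // (leq_trans kd).
move=> u us [u0 su _]; have [v vs vu] := submset_ex us.
have [||v0|vt] := sP v.
- exact: subseq_trans vs (take_subseq _ _).
- by rewrite (sum_perm vu).
- by exfalso; apply: u0; apply/nilP; rewrite /nilp -(perm_size vu) v0.
- by rewrite perm_sym in vu; apply: perm_trans vu vt.
Qed.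

(** * Transport along injective additive maps *)

Section Transport.

Variables (G H : zmodType) (f : G -> H).
Hypothesis fD : {morph f : x y / x + y}.
Hypothesis f_inj : injective f.

Lemma morph_add0 : f 0 = 0.
Proof. by apply: (addrI (f 0)); rewrite -fD !addr0. Qed.

Lemma morph_add_sum s : f (\sum_(x <- s) x) = \sum_(x <- map f s) x.
Proof. by rewrite big_map (big_morph f fD morph_add0). Qed.

Lemma sum_map_eq0 s : (\sum_(x <- map f s) x = 0) <-> (\sum_(x <- s) x = 0).
Proof.
rewrite -morph_add_sum -{1}morph_add0; split=> [/f_inj //|-> //].
Qed.

Lemma zsfree_map s : zsfree (map f s) <-> zsfree s.
Proof.
split=> sP u us su; last first.
  have [v vs uv] := subseq_map_ex us; move: su.
  by rewrite uv sum_map_eq0 => /(sP v vs) ->.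
have := sP (map f u) (map_subseq f us) ((sum_map_eq0 u).2 su).
by case: u {us su}.
Qed.

Lemma mzs_map t : mzs (map f t) <-> mzs t.
Proof.
split=> -[t0 st tP]; split.
- by move=> tE; apply: t0; rewrite tE.
- exact/sum_map_eq0.
- move=> u ut su.
  have [|||] := tP (map f u); first exact: map_subseq.
    exact/sum_map_eq0.
    by case: u {ut su} => //; left.
  by move/(inj_map f_inj) => ->; right.
- by case: t t0 {st tP}.
- exact/sum_map_eq0.
move=> u ut; have [v vt ->] := subseq_map_ex ut; rewrite sum_map_eq0.
by case/(tP v vt) => ->; [left|right].
Qed.

Lemma zs_bounded_inj d : zs_bounded H d -> zs_bounded G d.
Proof.
by move=> dH s sd /zsfree_map; apply: dH; rewrite size_map.
Qed.

Lemma zs_extendable_bij d (g : H -> G) : cancel g f ->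
  zs_extendable H d -> zs_extendable G d.
Proof.
move=> gK dH t /mzs_map/dH[s ds sP]; exists (map g s); first by rewrite size_map.
move=> u ugs su.
have [|||] := sP (map f u).
- by have := map_subseq f ugs; rewrite (mapK gK).
- exact/sum_map_eq0.
- by case: u {ugs su} => //; left.
by move/(perm_map_inj f_inj); right.
Qed.

End Transport.

Lemma isog_zmodP (G H : finZmodType) : [set: G] \isog [set: H] ->
  exists f : G -> H, {morph f : x y / x + y} /\ bijective f.
Proof.
case/isogP => f /injmP finj fT; exists f; split.
  by move=> x y; rewrite -!FinRing.zmodMgE morphM ?inE.
have fi : injective f by move=> x y fxy; apply: finj; rewrite ?inE.
apply: inj_card_bij => //.
rewrite -!cardsT -fT; apply: leq_trans (leq_imset_card _ _) _.
by rewrite subset_leq_card ?subsetIr.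
Qed.

(** * The Davenport constant of elementary abelian groups *)

Section Differences.

Variables (H : zmodType) (R : comNzRingType).
Implicit Types f g : H -> R.

(* Polynomials of degree less than [d], for functions on an abelian group. *)
Fixpoint deg_lt d f : Prop :=
  if d is d'.+1 then forall h, deg_lt d' (fun x => f (x + h) - f x)
  else forall x, f x = 0.

Lemma deg_lt0 d f : (forall x, f x = 0) -> deg_lt d f.
Proof.
elim: d f => // d IHd f f0 h; apply: IHd => x.
by rewrite !f0 subrr.
Qed.

Lemma deg_ltD d f g : deg_lt d f -> deg_lt d g ->
  deg_lt d (fun x => f x + g x).
Proof.
elim: d f g => [|d IHd] f g df dg; first by move=> x; rewrite df dg addr0.
move=> h; have := IHd _ _ (df h) (dg h).
by congr deg_lt; apply/funext => x; rewrite addrACA opprD.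
Qed.

Lemma deg_lt_shift d f h : deg_lt d f -> deg_lt d (fun x => f (x + h)).
Proof.
elim: d f => [|d IHd] f df; first by move=> x; apply: df.
move=> k; have := IHd _ (df k).
by congr deg_lt; apply/funext => x; rewrite addrAC.
Qed.

Lemma deg_lt_const d c : deg_lt d.+1 (fun=> c).
Proof. by move=> h; apply: deg_lt0 => x; rewrite subrr. Qed.

(** Leibniz rule for differences: each of the two summands lowers the degree of one factor, which
    allows induction on [a + b]. The index [a.+1] means degree at most [a]. *)
Lemma deg_ltM a b f g : deg_lt a.+1 f -> deg_lt b.+1 g ->
  deg_lt (a + b).+1 (fun x => f x * g x).
Proof.
have [n] := ubnP (a + b)%N; elim: n => // n IHn in a b f g *.
rewrite ltnS => abn df dg h.
have -> : (fun x => f (x + h) * g (x + h) - f x * g x) =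
    (fun x => (f (x + h) - f x) * g (x + h) + f x * (g (x + h) - g x)).
  by apply/funext => x; rewrite mulrBl mulrBr addrA subrK.
apply: deg_ltD.
  case: a abn df => [|a] abn df.
    by apply: deg_lt0 => x; rewrite (df h x) mul0r.
  by apply: (IHn a b); rewrite ?(leq_trans _ abn) ?ltnS //; apply: deg_lt_shift.
case: b abn dg => [|b] abn dg.
  by apply: deg_lt0 => x; rewrite (dg h x) mulr0.
by rewrite plusE addnS; apply: (IHn a b); rewrite -?addnS.
Qed.

Lemma deg_lt_exp f k : deg_lt 2 f -> deg_lt k.+1 (fun x => f x ^+ k).
Proof.
move=> df; elim: k => [|k IHk]; first exact: deg_lt_const.
have := deg_ltM df IHk; rewrite add1n; congr deg_lt.
by apply/funext => x; rewrite exprS.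
Qed.

Lemma deg_lt_prod (I : finType) (F : I -> H -> R) k :
  (forall i, deg_lt k.+1 (F i)) ->
  deg_lt (#|I| * k).+1 (fun x => \prod_i F i x).
Proof.
move=> dF; rewrite cardE.
have -> : (fun x => \prod_i F i x) = (fun x => \prod_(i <- enum I) F i x).
  by apply/funext => x; rewrite big_enum.
elim: (enum I) => [|i s IHs].
  rewrite (_ : (fun x => _) = (fun=> 1)); first exact: deg_lt_const.
  by apply/funext => x; rewrite big_nil.
have := deg_ltM (dF i) IHs; rewrite mulSn; congr deg_lt.
by apply/funext => x; rewrite big_cons.
Qed.

(* Differencing along [h] turns [f] into a function with value [- f 0] at 0 which
   still vanishes at the nonempty subsums of the rest of [s]. *)
Lemma zsfree_deg_lt f (s : seq H) : f 0 != 0 -> (forall x, x != 0 -> f x = 0) ->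
  zsfree s -> ~ deg_lt (size s) f.
Proof.
move=> f0 f1 sP.
have {f1 sP} : forall u, subseq u s -> u != [::] -> f (\sum_(x <- u) x) = 0.
  by move=> u us /eqP u0; apply: f1; apply/eqP => /(sP u us).
elim: s f f0 => [|h s IHs] f f0 fP /=.
  by move/(_ 0)/eqP; apply/negP.
move/(_ h); apply: IHs.
  rewrite add0r -[X in f X](big_seq1 +%R h (fun x => x)) fP.
  - by rewrite sub0r oppr_eq0.
  - by rewrite sub1seq mem_head.
  by [].
move=> u us u0; rewrite fP ?(subseq_trans us) ?subseq_cons // subr0.
have := fP (h :: u); rewrite big_cons addrC /= eqxx; exact.
Qed.

End Differences.

Lemma zs_bounded_rV (p r : nat) : prime p ->
  zs_bounded ('rV['F_p]_r) (r * p.-1).+1.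
Proof.
move=> p_pr s sr sP.
(* By Fermat's little theorem a factor is 1 if its coordinate is 0, and 0 otherwise; so [f] is the
   indicator function of 0. *)
pose f (x : 'rV['F_p]_r) := \prod_(i < r) (1 - x 0 i ^+ p.-1).
apply: (@zsfree_deg_lt _ _ f s _ _ sP).
- rewrite /f big1 ?oner_neq0 // => i _.
  by rewrite mxE expr0n eqn0Ngt -subn1 subn_gt0 prime_gt1 // subr0.
- move=> x /eqP x0; rewrite /f.
  have [i xi] : exists i, x 0 i != 0.
    apply/existsP; apply: contrapT => /negP; rewrite negb_exists => /forallP x'0.
    by apply: x0; apply/rowP => i; rewrite mxE; apply/eqP; rewrite -[_ == _]negbK.
  rewrite (bigD1 i) //= (_ : x 0 i ^+ p.-1 = 1) ?subrr ?mul0r //.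
  apply: (mulfI xi); rewrite mulr1 -exprS prednK ?prime_gt0 //.
  by rewrite -[in X in _ ^+ X](card_Fp p_pr) expf_card.
rewrite sr -[r in (r * _)%N]card_ord; apply: deg_lt_prod => i.
apply: deg_ltD; first exact: deg_lt_const.
have : deg_lt 2 (fun x : 'rV['F_p]_r => x 0 i).
  move=> h k x; rewrite /= !mxE.
  by rewrite [x 0 i + k 0 i + _]addrC addrK [x 0 i + h 0 i]addrC addrK subrr.
move/(deg_lt_exp p.-1) => d; have := deg_ltM (@deg_lt_const _ _ 0 (-1)) d.
by rewrite add0n; congr deg_lt; apply/funext => x; rewrite mulN1r.
Qed.

(** * Decision procedures in coordinates *)

Local Close Scope ring_scope.

Fixpoint subseqs (T : Type) (s : seq T) : seq (seq T) :=
  if s is x :: s' then map (cons x) (subseqs s') ++ subseqs s' else [:: [::]].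

Lemma mem_subseqs (T : eqType) (u s : seq T) : (u \in subseqs s) = subseq u s.
Proof.
elim: s u => [|x s IHs] u; first by rewrite inE subseq0.
rewrite [subseqs _]/= mem_cat IHs; case: u => [|y u]; first by rewrite sub0seq orbT.
rewrite [RHS]/=; have [->|yx] := eqVneq y x.
  rewrite mem_map ?IHs; last by move=> ? ? [].
  by apply/orP/idP => [[//|]|]; [apply: subseq_trans; apply: subseq_cons | left].
rewrite orbC; case: (subseq _ _) => //=; apply/mapP => -[v _ [yx' _]].
by rewrite yx' eqxx in yx.
Qed.

Fixpoint words (T : Type) (A : seq T) k : seq (seq T) :=
  if k is k'.+1 then allpairs cons A (words A k') else [:: [::]].

Lemma mem_words (T : eqType) (A : seq T) k s :
  (s \in words A k) = (size s == k) && all (mem A) s.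
Proof.
elim: k s => [|k IHk] [|x s] //=; first by apply/negbTE/negP => /allpairsP[[y u] /= [_ _]].
rewrite eqSS andbCA -IHk; apply/allpairsP/andP => [[[y u] [yA uA [-> ->]]]|[xA sA]] //.
by exists (x, s).
Qed.

Fixpoint vadd (v w : seq nat) : seq nat :=
  match v, w with
  | x :: v', y :: w' => (x + y) :: vadd v' w'
  | [::], _ => w
  | _, [::] => v
  end.

Definition vsum (vs : seq (seq nat)) := foldr vadd [::] vs.

(* Missing coordinates of [v] count as 0, superfluous ones are ignored. *)
Fixpoint zerov (ns v : seq nat) : bool :=
  match ns, v with n :: ns', k :: v' => (n %| k) && zerov ns' v' | _, _ => true end.

Definition zsfreeb ns vs := all (fun u => zerov ns (vsum u) ==> nilp u) (subseqs vs).

(** A subsequence of full length is the whole sequence, so comparing sizes replaces comparing lists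
    of vectors. *)
Definition mzsb ns vs := [&& ~~ nilp vs, zerov ns (vsum vs) & all
  (fun u => zerov ns (vsum u) ==> nilp u || (size u == size vs)) (subseqs vs)].

Local Open Scope ring_scope.

Section Coordinates.

Variable G : zmodType.

Fixpoint ev (e : seq G) (v : seq nat) : G :=
  match e, v with x :: e', k :: v' => x *+ k + ev e' v' | _, _ => 0 end.

(** The terms of [e] are independent of orders [ns]. They may span a proper subgroup of [G], so that
    an obstruction found in a subgroup can be applied to [G]. *)
Definition coordinates ns e := forall v, (ev e v == 0) = zerov ns v.

Lemma ev_nil e : ev e [::] = 0.
Proof. by case: e. Qed.

Lemma ev_vadd e v w : ev e (vadd v w) = ev e v + ev e w.
Proof.
elim: e v w => [|x e IHe] [|k v] [|l w]; rewrite ?addr0 ?add0r //=.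
by rewrite IHe mulrnDr addrACA.
Qed.

Lemma ev_vsum e vs : \sum_(x <- map (ev e) vs) x = ev e (vsum vs).
Proof.
elim: vs => [|v vs IHvs]; first by rewrite big_nil ev_nil.
by rewrite /= big_cons IHvs ev_vadd.
Qed.

Variables (ns : seq nat) (e : seq G).
Hypothesis eP : coordinates ns e.

Lemma ev_vsum_eq0 vs : (\sum_(x <- map (ev e) vs) x = 0) <-> zerov ns (vsum vs).
Proof. by rewrite -eP ev_vsum; split=> /eqP. Qed.

Lemma zsfreebP vs : zsfreeb ns vs <-> zsfree (map (ev e) vs).
Proof.
split=> [/allP vsP u us su|vsP].
  have [v vvs uE] := subseq_map_ex us; move: su; rewrite uE => /ev_vsum_eq0 v0.
  by have := vsP v; rewrite mem_subseqs vvs v0 => /(_ isT)/nilP ->.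
apply/allP => v; rewrite mem_subseqs => vvs; apply/implyP => /ev_vsum_eq0 v0.
by have := vsP _ (map_subseq _ vvs) v0; case: v {vvs v0}.
Qed.

Lemma mzsbP vs : mzsb ns vs <-> mzs (map (ev e) vs).
Proof.
split=> [/and3P[vs0 svs /allP vsP]|[vs0 svs vsP]].
  split; first by case: vs vs0 {svs vsP}.
    exact/ev_vsum_eq0.
  move=> u us su; have [v vvs uE] := subseq_map_ex us; move: su.
  rewrite uE => /ev_vsum_eq0 v0.
  have := vsP v; rewrite mem_subseqs vvs v0 => /(_ isT)/orP[/nilP ->|]; first by left.
  by move/eqP => vs_eq; right; rewrite (size_subseq_eq vvs) ?vs_eq.
apply/and3P; split; first by case: vs vs0 {svs vsP}.
  exact/ev_vsum_eq0.
apply/allP => v; rewrite mem_subseqs => vvs; apply/implyP => /ev_vsum_eq0 v0.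
have [v'|/(congr1 size)] := vsP _ (map_subseq _ vvs) v0.
  by case: v v' {vvs v0}.
by rewrite !size_map => ->; rewrite eqxx orbT.
Qed.

End Coordinates.

(** * Cyclic groups, by exhaustive search *)

Section Cyclic.

Definition residues n := [seq [:: i] | i <- iota 0 n].

Definition cyclic_boundedb n :=
  all (fun s => ~~ zsfreeb [:: n] s) (words (residues n) n).

(** The extensions searched are the sequences of length [n] with one term [x] and [n.-1] equal terms
    [h]. *)
Definition cyclic_extendableb n := all (fun k => all (fun t => mzsb [:: n] t ==>
    has (fun h => has (fun x =>
      all (fun u => zerov [:: n] (vsum u) ==> nilp u || perm_eq u t)
        (subseqs (x :: nseq n.-1 h))) (residues n)) (residues n))
  (words (residues n) k)) (iota 0 n.+1).

Variable n : nat.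
Hypothesis n1 : (1 < n)%N.

Lemma coordinates_Zp : coordinates [:: n] [:: (1 : 'Z_n)].
Proof.
case=> [|k v] /=; first by rewrite eqxx.
by rewrite addr0 andbT -val_eqE /= val_Zp_nat.
Qed.

Let pr (x : 'Z_n) : seq nat := [:: val x].

Lemma ev_val (x : 'Z_n) : ev [:: (1 : 'Z_n)] (pr x) = x.
Proof. by rewrite /= addr0 natr_Zp. Qed.

Lemma map_ev_val (s : seq 'Z_n) : map (ev [:: (1 : 'Z_n)]) (map pr s) = s.
Proof. by rewrite -map_comp -[RHS]map_id; apply: eq_map => x; exact: ev_val. Qed.

Lemma words_val (s : seq 'Z_n) : map pr s \in words (residues n) (size s).
Proof.
rewrite mem_words size_map eqxx /=; apply/allP => _ /mapP[x _ ->].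
apply/mapP; exists (val x) => //.
by rewrite mem_iota /= add0n -[X in (_ < X)%N](Zp_cast n1).
Qed.

Lemma zs_bounded_Zp : cyclic_boundedb n -> zs_bounded 'Z_n n.
Proof.
move=> /allP nP s sn sP; have := words_val s; rewrite sn => /nP.
move/negP; apply; apply/zsfreebP; first exact: coordinates_Zp.
by rewrite map_ev_val.
Qed.

Lemma zs_extendable_Zp : cyclic_boundedb n -> cyclic_extendableb n ->
  zs_extendable 'Z_n n.
Proof.
move=> /zs_bounded_Zp nB /allP nP t tP.
(* Otherwise the first [n] terms of [t] would be zero-sum free, contrary to the bound; hence the
   search over lengths 0 to [n] is complete. *)
have tn : (size t <= n)%N.
  rewrite leqNgt; apply/negP => nt; case: tP => _ _ tP.
  have nt' : (n <= size t)%N := ltnW nt.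
  apply: (nB (take n t)); first by rewrite size_takel.
  move=> u ut su; have [|//|//|uE] := tP u; first exact: subseq_trans ut (take_subseq _ _).
  have := size_subseq ut.
  by rewrite uE size_takel // leqNgt nt.
have := nP (size t); rewrite mem_iota ltnS tn => /(_ isT)/allP/(_ _ (words_val t)).
have -> : mzsb [:: n] (map pr t).
  by apply/(mzsbP coordinates_Zp); rewrite map_ev_val.
case/hasP => h _ /hasP[x _ /allP sP].
exists (map (ev [:: (1 : 'Z_n)]) (x :: nseq n.-1 h)).
  by rewrite size_map /= size_nseq prednK // ltnW.
move=> u us; have [v vs ->] := subseq_map_ex us.
move/(ev_vsum_eq0 coordinates_Zp) => v0.
have := sP v; rewrite mem_subseqs vs v0 => /(_ isT)/orP[/nilP ->|vt]; first by left.
by right; rewrite -[t]map_ev_val perm_map.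
Qed.

End Cyclic.

Lemma cyclic4 : cyclic_boundedb 4 && cyclic_extendableb 4.
Proof. by lazy. Qed.

Lemma cyclic5 : cyclic_boundedb 5 && cyclic_extendableb 5.
Proof. by lazy. Qed.

(** * Extending minimal zero-sum sequences over elementary abelian groups *)

Section Elementary.

Variables (p r : nat).
Hypothesis p_pr : prime p.
Local Notation F := 'F_p.
Local Notation V := 'rV[F]_r.

Definition mults n (I : seq 'I_n) : 'rV[F]_n := \row_i (count_mem i I)%:R.

Lemma sum_rows n (B : 'M[F]_(n, r)) (I : seq 'I_n) :
  \sum_(x <- [seq row i B | i <- I]) x = mults I *m B.
Proof.
rewrite big_map mulmx_sum_row; elim: I => [|j I IHI].
  by rewrite big_nil big1 // => i _; rewrite mxE scale0r.
rewrite big_cons IHI (bigD1 j) //= [RHS](bigD1 j) //= addrA; congr (_ + _).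
  by rewrite !mxE /= eqxx natrD scalerDl scale1r.
by apply: eq_bigr => i; rewrite !mxE /= eq_sym => /negPf->.
Qed.

Lemma Fp_nat_eq0 n : (n%:R == 0 :> F) = (p %| n)%N.
Proof. by rewrite -(dvdn_pcharf (pchar_Fp p_pr)). Qed.

Definition rows_mx (t : seq V) : 'M[F]_(size t, r) := \matrix_(i < size t) nth 0 t i.

Lemma map_rows_mx t : [seq row i (rows_mx t) | i <- enum 'I_(size t)] = t.
Proof.
rewrite -[RHS](mkseq_nth 0) /mkseq -val_enum_ord -map_comp.
by apply: eq_map => i; rewrite /= rowK.
Qed.

(** A relation with coefficients 0 and 1 is a zero-sum subsequence of [t], hence empty or all of [t]
    by minimality. *)
Lemma mzs_coef01 t (c : 'rV[F]_(size t)) : mzs t ->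
  (forall i, c 0 i = 0 \/ c 0 i = 1) -> c *m rows_mx t = 0 ->
  c = 0 \/ c = const_mx 1.
Proof.
move=> [t0 st tP] c01 cB.
pose I := [seq i <- enum 'I_(size t) | c 0 i == 1].
have Iu : uniq I by apply: filter_uniq; apply: enum_uniq.
have cE : c = mults I.
  apply/rowP => i; rewrite mxE count_uniq_mem //.
  rewrite mem_filter mem_enum andbT.
  by have [->|->] := c01 i; rewrite ?eqxx // eq_sym oner_eq0.
have It : subseq [seq row i (rows_mx t) | i <- I] t.
  by rewrite -[X in subseq _ X]map_rows_mx map_subseq // filter_subseq.
have [|I0|IT] := tP _ It; first by rewrite sum_rows -cE.
  left; rewrite cE; apply/rowP => i; rewrite !mxE.
  by case: (I) I0.
right; apply/rowP => i; rewrite mxE.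
have : I = enum 'I_(size t).
  apply: size_subseq_eq; first exact: filter_subseq.
  by rewrite -(size_map (fun i => row i (rows_mx t)) I) IT size_enum_ord.
have := mem_enum 'I_(size t) i; rewrite !inE => + IE.
by rewrite -IE mem_filter => /andP[/eqP].
Qed.

Lemma const_rows_mx t : \sum_(x <- t) x = 0 ->
  (const_mx 1 : 'rV_(size t)) *m rows_mx t = 0.
Proof.
move=> st; have <- : mults (enum 'I_(size t)) = const_mx 1.
  by apply/rowP => i; rewrite !mxE count_uniq_mem ?enum_uniq // mem_enum.
by rewrite -sum_rows map_rows_mx.
Qed.

Lemma mzs_rank t : mzs t -> (\rank (rows_mx t) < size t)%N.
Proof.
move=> [t0 st _]; rewrite ltn_neqAle rank_leq_row andbT; apply/negP => tfree.
have /eqP := const_rows_mx st; rewrite mulmx_free_eq0 //.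
case: t t0 {st tfree} => // x t _ /eqP/rowP/(_ ord0)/eqP.
by rewrite !mxE oner_eq0.
Qed.

(* [s] consists of [t], a second copy of the terms in [K], and [p - 1] copies of a basis
   of a complement of the span of [t]. *)
Lemma extend_mzs (t : seq V) (K : {set 'I_(size t)}) : mzs t ->
  K = finset.set0 \/ (2 < p)%N ->
  (forall c : 'rV[F]_(size t),
    (forall i, [\/ c 0 i = 0, c 0 i = 1 | i \in K]) ->
    c *m rows_mx t = 0 -> c = 0 \/ c = const_mx 1) ->
  exists2 s, size s = (size t + #|K| + p.-1 * (r - \rank (rows_mx t)))%N &
    forall u, subseq u s -> \sum_(x <- u) x = 0 -> u = [::] \/ perm_eq u t.
Proof.
move=> tP K2 KP; set B := rows_mx t in KP *.
pose M := row_base (B^C)%MS; pose q := \rank (B^C)%MS.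
pose rB := fun i => row i B; pose rM := fun i => row i M.
exists (map rB (enum 'I_(size t)) ++ map rB (enum K) ++
  map rM (flatten (nseq p.-1 (enum 'I_q)))).
  rewrite size_cat (size_map rB) size_enum_ord size_cat (size_map rB) -cardE.
  rewrite (size_map rM) size_flatten /shape map_nseq sumn_nseq size_enum_ord.
  by rewrite mulnC addnA /q mxrank_compl.
move=> u /subseq_cat_ex[u1 [u' [-> /subseq_map_ex[I1 I1s ->]]]].
move=> /subseq_cat_ex[u2 [u3 [-> /subseq_map_ex[I2 I2s ->] /subseq_map_ex[I3 I3s ->]]]].
rewrite catA -map_cat big_cat /= !sum_rows => sumE.
have I1u : uniq I1 by apply: subseq_uniq I1s (enum_uniq _).
have I2u : uniq I2 by apply: subseq_uniq I2s (enum_uniq _).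
(* The span of [t] meets its complement trivially, so both parts of the sum vanish. *)
have [c0 d0] : mults (I1 ++ I2) *m B = 0 /\ mults I3 *m M = 0.
  have dE : mults I3 *m M = - (mults (I1 ++ I2) *m B).
    by apply/eqP; rewrite -addr_eq0 addrC sumE.
  have : (mults I3 *m M <= B :&: B^C)%MS.
    rewrite sub_capmx {1}dE -scaleN1r scalemx_sub ?submxMl //=.
    by apply: submx_trans (submxMl _ _) _; rewrite eq_row_base.
  rewrite capmx_compl submx0 => /eqP d0; split=> //.
  by apply/eqP; rewrite -oppr_eq0 -dE d0.
(* The basis vectors are independent and each occurs at most [p.-1] times, too few for a nonzero
   multiplicity divisible by [p]. *)
have I30 : I3 = [::].
  have : mults I3 = 0.
    by apply/eqP; rewrite -(mulmx_free_eq0 _ (row_base_free (B^C)%MS)); apply/eqP.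
  move=> /rowP I3E; case: I3 I3s I3E {sumE d0} => // l I3 I3s /(_ l)/eqP.
  rewrite !mxE Fp_nat_eq0; set k := count _ _ => pk.
  have k0 : (0 < k)%N by rewrite /k /= eqxx.
  have := dvdn_leq k0 pk; have := leq_count_subseq (pred1 l) I3s; rewrite -/k.
  rewrite count_flatten map_nseq sumn_nseq count_uniq_mem ?enum_uniq //.
  rewrite mem_enum mul1n => kp pk'; have := leq_trans pk' kp.
  by rewrite -ltnS prednK ?prime_gt0 // ltnn.
have cnt i : count_mem i (I1 ++ I2) = ((i \in I1) + (i \in I2))%N.
  by rewrite count_cat !count_uniq_mem.
have I2K i : i \in I2 -> i \in K by move/(mem_subseq I2s); rewrite mem_enum.
(* Multiplicities below [p] can be recovered from their residues. They are at most 2, or at most 1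
   if [K] is empty, which is where the condition on [p] enters. *)
have cntp i : (count_mem i (I1 ++ I2) < p)%N.
  rewrite cnt; case: K2 => [K0|p2]; last first.
    by apply: leq_trans p2; rewrite ltnS; case: (_ \in _); case: (_ \in _).
  apply: leq_trans (prime_gt1 p_pr); rewrite ltnS.
  case: (boolP (i \in I2)) => [/I2K|_]; first by rewrite K0 inE.
  by rewrite addn0 leq_b1.
rewrite I30 cats0.
have [i|C0|C1] := KP (mults (I1 ++ I2)) _ c0.
- rewrite mxE cnt; case: (boolP (i \in I2)) => [/I2K|_]; first by constructor 3.
  by rewrite addn0; case: (i \in I1); [constructor 2|constructor 1].
- left; case E : (I1 ++ I2) => [//|l I].
  have := cntp l; move/rowP/(_ l)/eqP: C0; rewrite !mxE Fp_nat_eq0 => /dvdn_leq.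
  have -> : (0 < count_mem l (I1 ++ I2))%N by rewrite E /= eqxx.
  by move/(_ isT); rewrite ltnNge => ->.
right; rewrite -[X in perm_eq _ X]map_rows_mx; apply: perm_map.
apply/allP => i _; rewrite /= [X in _ == X]count_uniq_mem ?enum_uniq // mem_enum.
apply/eqP; have := cntp i; move/rowP/(_ i)/eqP: C1; rewrite !mxE.
case: (count_mem i _) => [|k]; first by rewrite eq_sym oner_eq0.
rewrite -subr_eq0 -[k.+1]addn1 natrD addrK Fp_nat_eq0.
case: k => // k /dvdn_leq - /(_ isT) pk; rewrite addn1 => /ltnW kp.
by have := leq_ltn_trans pk kp; rewrite ltnn.
Qed.

End Elementary.

(** Over the field with two elements every coefficient is 0 or 1, so no term need be doubled. The
    length suffices because the rank of [t] is less than its size. *)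
Lemma zs_extendable_F2 r : zs_extendable ('rV['F_2]_r) r.+1.
Proof.
move=> t tP; have [//||c _ cB|s sz sP] := extend_mzs (p := 2) (K := finset.set0) _ tP.
- by left.
- apply: mzs_coef01 tP _ cB => i; case: (c 0 i) => -[|[|//]] ci.
    by left; apply: val_inj.
  by right; apply: val_inj.
exists s => //; rewrite sz cards0 addn0 mul1n.
have := mzs_rank tP; have := rank_leq_col (rows_mx t).
move: (\rank _) => k; move: (size t) => n kr kn.
by rewrite -{1}(subnKC kr) ltn_add2r.
Qed.

(** * Minimal blocking sets in ternary affine spaces *)

Local Close Scope ring_scope.

Fixpoint comb (T : Type) k (s : seq T) : seq (seq T) :=
  match k, s with
  | 0, _ => [:: [::]]
  | _.+1, [::] => [::]
  | k'.+1, x :: s' => map (cons x) (comb k' s') ++ comb k s'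
  end.

Lemma mem_comb (T : eqType) k (u s : seq T) :
  (u \in comb k s) = (size u == k) && subseq u s.
Proof.
elim: s k u => [|x s IHs] [|k] u /=.
- by rewrite inE; case: u.
- by case: u => //= *; rewrite andbF.
- by rewrite inE -size_eq0; case: u => //.
rewrite mem_cat IHs; case: u => [|y u] //=.
  by rewrite orbF; apply/mapP => -[].
have [->|yx] := eqVneq y x.
  rewrite mem_map; last by move=> ? ? [].
  rewrite IHs eqSS -andb_orr; case: (_ == _) => //=.
  by apply/orP/idP => [[//|]|]; [apply: subseq_trans; apply: subseq_cons | left].
rewrite orbC; case: (_ && _) => //=; apply/mapP => -[v _ [yx' _]].
by rewrite yx' eqxx in yx.
Qed.

Fixpoint dot (w v : seq nat) :=
  match w, v with x :: w', y :: v' => x * y + dot w' v' | _, _ => 0 end.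

Definition ag_points m := [seq v <- words [:: 0; 1; 2] m | sumn v %% 3 == 1].

Definition unit_vecs m := [seq [seq (i == j : nat) | j <- iota 0 m] | i <- iota 0 m].

(* The points of [A] together with the unit vectors [U] would form a minimal
   blocking set of the affine space of vectors with coordinate sum 1; a functional
   avoiding the value 2 on [U] has coordinates in {0, 1}, whence the range [W]. *)
Definition minimal_blocking m (A : seq (seq nat)) :=
  let U := unit_vecs m in
  let W := [seq w <- words [:: 0; 1] m | ~~ constant w] in
  [&& all (fun w => has (fun v => dot w v %% 3 == 2) A) W,
    all (fun v => has (fun w => (dot w v %% 3 == 2) &&
      all (fun v' => (v' == v) || (dot w v' %% 3 != 2)) A) W) A &
    all (fun v => has (fun w => (dot w v %% 3 == 2) &&
      all (fun v' => (v' == v) || (dot w v' %% 3 != 2)) (A ++ U))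
      (words [:: 0; 1; 2] m)) U].

Definition no_minimal_blockingb m k := all (fun A => ~~ minimal_blocking m A)
  (comb k [seq v <- ag_points m | v \notin unit_vecs m]).

(* Proved with [lazy], since call by value would evaluate both sides of every [&&]. *)
Lemma no_minimal_blockingT : all (fun mk => no_minimal_blockingb mk.1 mk.2)
  [seq (m, k) | m <- iota 1 4, k <- iota m (5 - m)].
Proof. by lazy. Qed.

(** Here [k] counts the points besides the [m] unit vectors. A blocking set with at least 2m and at
    most m + 4 points falls into this range. *)
Lemma no_minimal_blocking m k A : 0 < m <= k -> k <= 4 -> size A = k ->
  subseq A [seq v <- ag_points m | v \notin unit_vecs m] ->
  ~~ minimal_blocking m A.
Proof.
move=> /andP[m0 mk] k4 sA AP.
have m4 := leq_trans mk k4.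
have /(allP no_minimal_blockingT)/allP : (m, k) \in
    [seq (m, k) | m <- iota 1 4, k <- iota m (5 - m)].
  apply/allpairsPdep; exists m, k; rewrite !mem_iota m0 mk ltnS m4 subnKC //.
  by apply: leqW.
by apply; rewrite mem_comb sA eqxx.
Qed.

Local Open Scope ring_scope.

(** * From ternary codes to blocking sets *)

Section BlockingCodes.

Local Notation F := 'F_3.

Lemma F3_cases (x : F) : [\/ x = 0, x = 1 | x = 2%:R].
Proof.
by case: x => -[|[|[|//]]] i; [constructor 1|constructor 2|constructor 3]; apply: val_inj.
Qed.

Lemma F3_nat_eq2 n : (n%:R == 2%:R :> F) = (n %% 3 == 2)%N.
Proof. by rewrite -val_eqE /= !val_Fp_nat. Qed.

Definition pt m n (P : 'M[F]_(m, n)) (j : 'I_n) : seq nat :=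
  [seq val (P i j) | i <- enum 'I_m].

Definition covec m (w : seq nat) : 'rV[F]_m := \row_i (nth 0%N w i)%:R.

Lemma dot_pt m n (P : 'M[F]_(m, n)) w j : size w = m ->
  (dot w (pt P j))%:R = (covec m w *m P) 0 j.
Proof.
move=> wm; rewrite mxE /pt.
rewrite (eq_bigr (fun i : 'I__ => (nth 0%N w i * val (P i j))%:R)); last first.
  by move=> i _; rewrite mxE natrM natr_Zp.
elim: m w P wm => [|m IHm] [|x w] P //= wm.
  by rewrite big_ord0.
case: wm => wm.
rewrite enum_ordSl /= big_ord_recl natrD; congr (_ + _).
have := IHm w (row' 0 P) wm; rewrite -map_comp => IH.
rewrite (eq_bigr (fun i : 'I__ => (nth 0%N w i * val (row' 0 P i j))%:R)); last first.
  by move=> i _; rewrite !mxE.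
rewrite -IH; congr (_%:R); congr dot; apply: eq_map => i.
by rewrite /= !mxE.
Qed.

Lemma covec_pt m n (P : 'M[F]_(m, n)) j : covec m (pt P j) = (col j P)^T.
Proof.
apply/rowP => i; rewrite !mxE /pt (nth_map i) ?size_enum_ord //.
by rewrite nth_ord_enum natr_Zp.
Qed.

Lemma pt_words m n (P : 'M[F]_(m, n)) j : pt P j \in words [:: 0; 1; 2]%N m.
Proof.
rewrite mem_words size_map size_enum_ord eqxx /=; apply/allP => _ /mapP[i _ ->].
by case: (P i j) => -[|[|[|]]].
Qed.

Lemma words_uniq (T : eqType) (A : seq T) k : uniq A -> uniq (words A k).
Proof.
move=> uA; elim: k => //= k IHk; apply: allpairs_uniq => // -[x u] [y v] _ _ /=.
by case=> -> ->.
Qed.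

(** The columns at [f] are the unit vectors, and all columns have coordinate sum 1. A functional [a]
    cuts out the hyperplane where it equals 2: the fourth hypothesis on [P] says that the columns in
    [J] meet every such hyperplane, the fifth that each of them is alone on some hyperplane. *)
Lemma normal_code_bound m n (P : 'M[F]_(m, n)) (f : 'I_m -> 'I_n) (J : {set 'I_n}) :
  (0 < m)%N -> (forall i, f i \in J) -> colsub f P = 1%:M ->
  const_mx 1 *m P = (const_mx 1 : 'rV_n) ->
  (forall a : 'rV_m, (forall j, j \in J -> (a *m P) 0 j != 2%:R) ->
    a *m P = 0 \/ a *m P = const_mx 1) ->
  (forall j, j \in J -> exists2 a : 'rV_m, (a *m P) 0 j = 2%:R &
    forall i, i \in J -> i != j -> (a *m P) 0 i != 2%:R) ->
  (#|J| <= m + 4)%N -> (#|J| < m.*2)%N.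
Proof.
move=> m0 fJ fP P1 blockP essP Jm; rewrite ltnNge; apply/negP => mJ.
have aPf (a : 'rV_m) i : (a *m P) 0 (f i) = a 0 i.
  have : colsub f (a *m P) = a by rewrite -mulmx_colsub fP mulmx1.
  by move/rowP/(_ i); rewrite mxE.
have dotE w j : size w = m ->
    (dot w (pt P j) %% 3 == 2)%N = ((covec m w *m P) 0 j == 2%:R).
  by move=> wm; rewrite -dot_pt // F3_nat_eq2.
have covecK (a : 'rV[F]_m) : exists2 w, w \in words [:: 0; 1; 2]%N m & covec m w = a.
  exists (pt a^T 0); first exact: pt_words.
  by rewrite covec_pt; apply/rowP => i; rewrite !mxE.
have ptf (i : 'I_m) : pt P (f i) = [seq (val i == j : nat) | j <- iota 0 m].
  rewrite -val_enum_ord -map_comp; apply: eq_map => j /=.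
  have := congr1 (fun A : 'M_m => A j i) fP; rewrite !mxE => ->.
  by rewrite [RHS]/= -val_eqE eq_sym; case: eqP.
have UE : unit_vecs m = [seq pt P (f i) | i <- enum 'I_m].
  rewrite (eq_map (fun i => ptf i)) -val_enum_ord.
  by rewrite (map_comp (fun i => [seq (i == j : nat) | j <- _])) val_enum_ord.
pose L := [seq pt P j | j <- enum J].
(* Two equal columns would lie on the same hyperplanes, so neither could be alone on one. *)
have pt_inj : {in J &, injective (pt P)}.
  move=> i j iJ jJ ij; apply/eqP; apply: contraT => ne_ij.
  have [a aj /(_ _ iJ ne_ij)] := essP j jJ; rewrite -aj => /eqP; case.
  rewrite !mxE; apply: eq_bigr => k _; congr (_ * _); apply: val_inj.
  by move/eq_in_map: ij => /(_ k (mem_enum _ _)).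
have LU v : v \in unit_vecs m -> v \in L.
  rewrite UE => /mapP[i _ ->]; by apply: map_f; rewrite mem_enum.
have uL : uniq L.
  by rewrite map_inj_in_uniq ?enum_uniq // => i j; rewrite !mem_enum; apply: pt_inj.
have uU : uniq (unit_vecs m).
  rewrite UE map_inj_in_uniq ?enum_uniq // => i j _ _ /pt_inj fij.
  have {}fij := fij (fJ i) (fJ j).
  have := congr1 (fun A : 'M_m => A i j) fP; rewrite !mxE -fij.
  have := congr1 (fun A : 'M_m => A i i) fP; rewrite !mxE eqxx => ->.
  by case: eqP => // _ /eqP; rewrite oner_eq0.
have Lag v : v \in L -> v \in ag_points m.
  case/mapP => j _ ->; rewrite mem_filter pt_words andbT.
  have := congr1 (fun A : 'rV_n => A 0 j) P1; rewrite !mxE.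
  rewrite (eq_bigr (fun i => (val (P i j))%:R)); last first.
    by move=> i _; rewrite mxE mul1r natr_Zp.
  rewrite -natr_sum => /eqP; rewrite -val_eqE /= val_Fp_nat //.
  by rewrite sumnE big_map big_enum.
pose A := [seq v <- [seq v <- ag_points m | v \notin unit_vecs m] | v \in L].
have AU : A ++ unit_vecs m =i L.
  move=> v; rewrite mem_cat 2!mem_filter; case: (boolP (v \in L)) => vL /=.
    by rewrite Lag // andbT orNb.
  by apply/negP => /LU; apply/negP.
have sA : size A = (#|J| - m)%N.
  have -> : #|J| = size L by rewrite size_map -cardE.
  have uAU : uniq (A ++ unit_vecs m).
    rewrite cat_uniq uU andbT !filter_uniq ?words_uniq //=.
    by apply/hasPn => v vU; rewrite !mem_filter vU andbF.
  rewrite -(perm_size (uniq_perm uAU uL AU)) size_cat UE size_map size_enum_ord.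
  by rewrite addnK.
have ess j : j \in J -> exists w, [/\ w \in words [:: 0; 1; 2]%N m,
    (dot w (pt P j) %% 3 == 2)%N & forall v, v \in L -> v != pt P j ->
    (dot w v %% 3 != 2)%N].
  move=> jJ; have [a aj aN] := essP j jJ; have [w wW wa] := covecK a.
  have wm : size w = m by move: wW; rewrite mem_words => /andP[/eqP].
  exists w; split=> //; first by rewrite dotE // wa aj.
  move=> _ /mapP[i iJ ->] ne_ij; rewrite dotE // wa; apply: aN.
    by rewrite mem_enum in iJ.
  by apply: contraNneq ne_ij => ->.
have Amin : minimal_blocking m A.
  apply/and3P; split.
  - apply/allP => w; rewrite mem_filter mem_words => /and3P[wN /eqP wm /allP w01].
    apply: contraT => /hasPn wA; exfalso; move/negP: wN; apply.
    have [|w0|w1] := blockP (covec m w).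
    + move=> j jJ; rewrite -dotE //.
      have : pt P j \in L by apply: map_f; rewrite mem_enum.
      rewrite -AU mem_cat => /orP[/wA //|]; rewrite UE => /mapP[i _ ->].
      rewrite dotE // aPf mxE F3_nat_eq2.
      have : nth 0%N w i \in w by rewrite mem_nth ?wm.
      by move/w01; rewrite !inE => /orP[] /eqP->.
    + have -> : w = nseq m 0%N; last exact: constant_nseq.
      apply: (@eq_from_nth _ 0%N); rewrite ?size_nseq // => i; rewrite wm => im.
      rewrite nth_nseq im.
      have := aPf (covec m w) (Ordinal im); rewrite w0 !mxE /=.
      have : nth 0%N w i \in w by rewrite mem_nth ?wm.
      by move/w01; rewrite !inE => /orP[] /eqP->.
    have -> : w = nseq m 1%N; last exact: constant_nseq.
    apply: (@eq_from_nth _ 0%N); rewrite ?size_nseq // => i; rewrite wm => im.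
    rewrite nth_nseq im.
    have := aPf (covec m w) (Ordinal im); rewrite w1 !mxE /=.
    have : nth 0%N w i \in w by rewrite mem_nth ?wm.
    by move/w01; rewrite !inE => /orP[] /eqP->.
  - apply/allP => v vA.
    have : v \in L by move: vA; rewrite mem_filter => /andP[].
    case/mapP=> j; rewrite mem_enum => jJ vj; have [w [wW wj wN]] := ess j jJ.
    move: wW; rewrite mem_words => /andP[/eqP wm /allP w012].
    (* The point [v] is no unit vector, so a functional with value 2 only at [v] avoids 2 on the
       unit vectors; its coordinates are its values there. *)
    have w01 i : (i < m)%N -> nth 0%N w i \in [:: 0; 1]%N.
      move=> im; have /w012 : nth 0%N w i \in w by rewrite mem_nth ?wm.
      have : pt P (f (Ordinal im)) \in L by apply: map_f; rewrite mem_enum.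
      move/wN; rewrite dotE // aPf mxE /= F3_nat_eq2 => wi.
      rewrite !inE => /or3P[/eqP-> //|/eqP-> //|/eqP wi2].
      have [fv|] := eqVneq (pt P (f (Ordinal im))) v; last first.
        by rewrite vj => /wi; rewrite wi2.
      have vU : v \in unit_vecs m.
        by rewrite UE -fv; apply: (map_f (fun i => pt P (f i))); rewrite mem_enum.
      by move: vA; rewrite 2!mem_filter vU andbF.
    apply/hasP; exists w.
      rewrite mem_filter mem_words wm eqxx /=; apply/andP; split; last first.
        apply/allP => x /(nthP 0%N)[i]; rewrite wm => im <-; exact: w01.
      (* A constant [w] takes the value [c] on all columns, as they have sum 1; but [c] is 0 or
         1. *)
      apply/negP => /(constantP 0%N)[c wc].
      have cw i : (i < m)%N -> nth 0%N w i = c.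
        by move=> im; rewrite wc nth_nseq wm im.
      have := wj; rewrite dotE //.
      have -> : covec m w = c%:R *: const_mx 1.
        by apply/rowP => i; rewrite !mxE cw // mulr1.
      rewrite -scalemxAl P1 !mxE mulr1 F3_nat_eq2.
      by have := w01 0%N m0; rewrite cw // !inE => /orP[] /eqP->.
    rewrite vj wj /=; apply/allP => v' v'A; case: eqP => //= /eqP v'j.
    by apply: wN => //; move: v'A; rewrite mem_filter => /andP[].
  apply/allP => v; rewrite {1}UE => /mapP[i _ ->]; have [w [wW wj wN]] := ess _ (fJ i).
  apply/hasP; exists w => //; rewrite wj /=; apply/allP => v'; rewrite AU => v'L.
  by case: eqP => //= /eqP; apply: wN.
have mk : (m <= #|J| - m)%N.
  by rewrite leq_subRL ?addnn // (leq_trans _ mJ) // -addnn leq_addr.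
have k4 : (#|J| - m <= 4)%N by rewrite leq_subLR.
have m0k : (0 < m <= #|J| - m)%N by rewrite m0 mk.
exact: (negP (no_minimal_blocking m0k k4 sA (filter_subseq _ _)) Amin).
Qed.

End BlockingCodes.

(** * Extension over powers of Z_3 *)

Section TernaryExtension.

Local Notation F := 'F_3.

(** Reduction to systematic form by a change of basis. A word vanishing on [J] avoids 2 there, so it
    is 0 or all-ones, and the latter is impossible for nonempty [J]. Hence the columns in [J] have
    full rank and contain a basis. *)
Lemma code_bound m n (M : 'M[F]_(m, n)) (J : {set 'I_n}) :
  (0 < n)%N -> row_free M -> (exists a, a *m M = (const_mx 1 : 'rV_n)) ->
  (forall a : 'rV_m, (forall j, j \in J -> (a *m M) 0 j != 2%:R) ->
    a *m M = 0 \/ a *m M = const_mx 1) ->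
  (forall j, j \in J -> exists2 a : 'rV_m, (a *m M) 0 j = 2%:R &
    forall i, i \in J -> i != j -> (a *m M) 0 i != 2%:R) ->
  (#|J| <= m + 4)%N -> (#|J| < m.*2)%N.
Proof.
move=> n0 Mfree [a1 a1M] blockM essM Jm.
have m0 : (0 < m)%N.
  rewrite lt0n; apply/eqP => m0; move: a1 a1M; rewrite {}m0 in M {Mfree blockM essM Jm} *.
  move=> a1; rewrite [a1]thinmx0 mul0mx => /rowP/(_ (Ordinal n0))/eqP.
  by rewrite !mxE eq_sym oner_eq0.
(* Twice the all-ones word is neither 0 nor all-ones, so it must take the value 2 somewhere on
   [J]. *)
have [j0 j0J] : exists j0, j0 \in J.
  apply/finset.set0Pn/negP => /eqP J0.
  have [j|a2|a2] := blockM (2%:R *: a1); first by rewrite J0 inE.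
    move: a2; rewrite -scalemxAl a1M => /rowP/(_ (Ordinal n0)).
    by rewrite !mxE.
  move: a2; rewrite -scalemxAl a1M => /rowP/(_ (Ordinal n0)).
  by rewrite !mxE.
pose h := @enum_val _ (mem J).
have hJ i : h i \in J by apply: enum_valP.
have MJfree : row_free (colsub h M).
  apply: inj_row_free => v; rewrite mulmx_colsub => vM.
  have vMJ j : j \in J -> (v *m M) 0 j = 0.
    move=> jJ; move/rowP/(_ (enum_rank_in jJ j)): vM.
    by rewrite !mxE /h enum_rankK_in.
  have [j jJ||v1] := blockM v; first by rewrite vMJ.
    by move/eqP; rewrite mulmx_free_eq0 // => /eqP.
  by move: (vMJ j0 j0J); rewrite v1 mxE => /eqP; rewrite oner_eq0.
have MJfull : row_full (colsub h M)^T by rewrite /row_full mxrank_tr.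
pose f i := h (fullrankfun MJfull i).
have fu : colsub f M \in unitmx.
  rewrite -unitmx_tr trmx_mxsub.
  have -> : rowsub f M^T = rowsub (fullrankfun MJfull) (colsub h M)^T.
    by apply/matrixP => i j; rewrite !mxE.
  exact: fullrowsub_unit.
pose P := invmx (colsub f M) *m M.
have PM a : a *m P = (a *m invmx (colsub f M)) *m M by rewrite mulmxA.
have MP a : a *m M = (a *m colsub f M) *m P by rewrite PM mulmxK.
have fP : colsub f P = 1%:M by rewrite -mulmx_colsub mulVmx.
apply: (@normal_code_bound m n P f J) => //.
- move=> i; exact: hJ.
- have : (a1 *m colsub f M) = const_mx 1.
    by rewrite mulmx_colsub a1M mxsub_const.
  by move=> <-; rewrite -MP.
- by move=> a; rewrite PM; apply: blockM.
move=> j /essM[a aj aN]; exists (a *m colsub f M); rewrite -MP //.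
Qed.

(* [Q K] says that doubling the terms in [K] creates no relation besides [t]. *)
Lemma zs_extendable_F3 r : (r <= 4)%N -> zs_extendable ('rV[F]_r) (r * 2).+1.
Proof.
move=> r4 t tP; set B := rows_mx t.
pose Q (K : {set 'I_(size t)}) := [forall c : 'rV[F]_(size t),
  [forall i, [|| c 0 i == 0, c 0 i == 1 | i \in K]] ==> (c *m B == 0) ==>
  ((c == 0) || (c == const_mx 1))].
have QP (K : {set 'I_(size t)}) : reflect (forall c : 'rV[F]_(size t),
    (forall i, [\/ c 0 i = 0, c 0 i = 1 | i \in K]) ->
    c *m B = 0 -> c = 0 \/ c = const_mx 1) (Q K).
  apply: (iffP forallP) => QK c.
    move=> c01 cB; move: (QK c); rewrite cB eqxx implyTb => /implyP.
    case/(_ _)/orP => [|/eqP->|/eqP->]; [|by left|by right].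
    by apply/forallP => i; apply/or3P; case: (c01 i) => [->|->|->];
      [constructor 1|constructor 2|constructor 3].
  apply/implyP => /forallP c01; apply/implyP => /eqP cB; apply/orP.
  have [|->|->] := QK c _ cB; [|by left|by right].
  move=> i; case/or3P: (c01 i) => [/eqP|/eqP|]; first by constructor 1.
    by constructor 2.
  by constructor 3.
have Q0 : Q finset.set0.
  apply/QP => c c01; apply: mzs_coef01 tP _ => // i.
  by case: (c01 i) => [->|->|]; [left|right|rewrite inE].
have [K /maxsetP[/QP QK Kmax] _] := maxset_exists Q0.
have [s ss sP] := extend_mzs (p := 3) isT tP (or_intror isT) QK.
exists s => //; rewrite ss.
have kerE (c : 'rV[F]_(size t)) : c *m B = 0 ->
    exists a, a *m row_base (kermx B) = c.
  move=> cB; have /submxP[a ->] : (c <= row_base (kermx B))%MS.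
    by rewrite eq_row_base; apply/sub_kermxP.
  by exists a.
have kerB (a : 'rV_(\rank (kermx B))) : a *m row_base (kermx B) *m B = 0.
  by apply/sub_kermxP; apply: submx_trans (submxMl _ _) _; rewrite eq_row_base.
have rB : (\rank B <= r)%N := rank_leq_col B.
have Bt : (\rank B < size t)%N := mzs_rank tP.
have KN : (#|K| + #|~: K| = size t)%N by rewrite cardsC card_ord.
(* The code is the space of relations of [t], of dimension m = [size t - \rank B]. *)
have : (#|~: K| < (\rank (kermx B)).*2)%N.
  apply: (@code_bound _ _ (row_base (kermx B)) (~: K)).
  - by apply: leq_ltn_trans Bt.
  - exact: row_base_free.
  - by apply: kerE; apply: const_rows_mx; case: tP.
  - move=> a aK; apply: QK; last exact: kerB.
    move=> i; have [iK|iK] := boolP (i \in K); first by constructor 3.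
    have := aK i; rewrite inE iK => /(_ isT).
    case: (F3_cases ((a *m row_base (kermx B)) 0 i)) => -> //.
      by constructor 1.
    by constructor 2.
  - move=> j; rewrite inE => jK.
    (* Maximality of [K] yields a new relation once [j] is released; it must take the value 2 at
       [j], and only 0 and 1 elsewhere outside [K]. *)
    have : ~~ Q (j |: K).
      apply/negP => /Kmax/(_ (finset.subsetUr _ _)) Kj.
      by move: jK; rewrite -Kj setU11.
    move=> /negP Qj.
    have [c [c01 cB c0 c1]] : exists c : 'rV[F]_(size t),
        [/\ forall i, [\/ c 0 i = 0, c 0 i = 1 | i \in j |: K], c *m B = 0,
            c <> 0 & c <> const_mx 1].
      apply: contrapT => noc; apply: Qj; apply/QP => c c01 cB.
      have [->|/eqP c0] := eqVneq c 0; first by left.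
      have [->|/eqP c1] := eqVneq c (const_mx 1); first by right.
      by case: noc; exists c.
    have cj : c 0 j = 2%:R.
      case: (F3_cases (c 0 j)) => // cj.
        have [i||] := QK c _ cB => //.
        by case: (c01 i) => [?|?|/setU1P[->|?]];
          [constructor 1|constructor 2|constructor 1|constructor 3].
      have [i||] := QK c _ cB => //.
      by case: (c01 i) => [?|?|/setU1P[->|?]];
        [constructor 1|constructor 2|constructor 2|constructor 3].
    have [a aE] := kerE c cB; exists a; rewrite aE // => i.
    rewrite inE => iK ij.
    case: (c01 i) => [->|->|] //.
    by rewrite in_setU1 (negPf ij) (negPf iK).
  (* The size of [~: K] is at most [size t], which is m + [\rank B], hence at most m + 4. *)
  rewrite mxrank_ker; move: r4 rB Bt KN.
  move: (\rank B) #|K| #|~: K| => k a b; move: (size t) => n; clear; lia.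
(* The length of [s] equals 2r + 2m minus the size of [~: K], so it exceeds 2r. *)
rewrite mxrank_ker -/B /=; move: r4 rB Bt KN.
move: (\rank B) #|K| #|~: K| => k a b; move: (size t) => n; clear; lia.
Qed.

End TernaryExtension.

(** * Obstructions to minimality *)

Section Obstruction.

Variables (G : finZmodType) (t s : seq G).
Hypotheses (tP : mzs t) (sD : davenport G = Some (size s)) (ts : only_mzs t s).

Lemma only_mzs_sub z :
  submset z s -> z <> [::] -> \sum_(x <- z) x = 0 -> submset t z.
Proof.
move=> zs z0 sz; have [u uz uP] := mzs_ex z0 sz.
have us : submset u s := submset_trans (submset_subseq uz) zs.
apply: submset_trans (submset_subseq uz).
by apply: perm_submset; rewrite perm_sym; apply: ts.
Qed.

Lemma only_mzs_submset : submset t s.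
Proof.
have sN : ~ zsfree s by apply: (davenport_le sD).
apply: contrapT => tNs; apply: sN => u us su; apply: contrapT => u0; apply: tNs.
apply: submset_trans (submset_subseq us).
by apply: only_mzs_sub => //; apply: submset_subseq.
Qed.

(* The terms of [s] outside [t], together with [w], form a zero-sum free sequence. *)
Lemma only_mzs_count w : zsfree w ->
  (forall u, subseq u w ->
    exists2 x, subseq x t & \sum_(y <- u) y + \sum_(y <- x) y = 0) ->
  (size w < count (mem t) s)%N.
Proof.
move=> wP wt; rewrite ltnNge; apply/negP => sw.
pose v := [seq y <- s | y \notin t].
have sv : (size v + count (mem t) s = size s)%N.
  by rewrite size_filter addnC count_predC.
have vw : (size s <= size (v ++ w))%N by rewrite size_cat -sv leq_add2l.
apply: (davenport_le sD vw) => _ /subseq_cat_ex[u1 [u2 [-> u1v u2w]]].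
rewrite big_cat /= => sum12.
have vt y : y \in t -> count_mem y u1 = 0%N.
  move=> yt; apply/count_memPn; apply/negP => /(mem_subseq u1v).
  by rewrite mem_filter yt.
(* The complement [x'] of [x] in [t] has the same sum as [u2], so [u2] can be traded for terms of
   [t]. *)
have [x xt sx] := wt u2 u2w; have [x' tx] := perm_to_subseq xt.
have sx' : \sum_(y <- x') y = \sum_(y <- u2) y.
  case: tP => _; rewrite (sum_perm tx) big_cat /= => st _.
  by apply: (addIr (\sum_(y <- x) y)); rewrite sx addrC st.
have [z0|/eqP z0] := eqVneq (u1 ++ x') [::].
  have [u10 x'0] : u1 = [::] /\ x' = [::] by case: (u1) (x') z0 => // -[].
  by rewrite u10 (wP u2) //; rewrite -sx' x'0 big_nil.
(* As [u1] has no terms of [t], this forces [x'] to be all of [t]; then [x] is empty and [u2] has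
   sum 0. *)
have tz : submset t (u1 ++ x').
  apply: only_mzs_sub => //; last by rewrite big_cat /= sx'.
  move=> y; rewrite count_cat; have [yt|yt] := boolP (y \in t).
    rewrite vt // add0n; apply: leq_trans (only_mzs_submset y).
    by move/seq.permP: tx => ->; rewrite count_cat leq_addl.
  have -> : count_mem y x' = 0%N.
    apply/count_memPn; apply: contra yt => yx'.
    by rewrite (perm_mem tx) mem_cat yx' orbT.
  rewrite addn0; apply: leq_count_subseq.
  exact: subseq_trans u1v (filter_subseq _ _).
have x0 : x = [::].
  have : submset t x'.
    move=> y; have := tz y; rewrite count_cat; have [yt|yt] := boolP (y \in t).
      by rewrite vt.
    by move/count_memPn: yt => ->.
  move/submset_size; rewrite (perm_size tx) size_cat.
  by case: (x) => //= y x1; rewrite ltnNge leq_addl.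
have u20 : u2 = [::] by apply: wP => //; move: sx; rewrite x0 big_nil addr0.
rewrite u20 cats0; apply: contrapT => u10.
have tu : submset t u1.
  apply: only_mzs_sub => //; last by rewrite u20 big_nil addr0 in sum12.
  apply: submset_subseq; exact: subseq_trans u1v (filter_subseq _ _).
case: tP => t0 _ _; case: (t) t0 tu vt => // y t1 _ /(_ y) tu /(_ y).
by rewrite mem_head => /(_ isT) u1y; move: tu; rewrite u1y /= eqxx.
Qed.

(* By the last hypothesis, a further copy of [y] in [s] would yield a zero-sum
   subsequence too short to contain [t]. *)
Lemma only_mzs_size w : zsfree w ->
  (forall u, subseq u w ->
    exists2 x, subseq x t & \sum_(y <- u) y + \sum_(y <- x) y = 0) ->
  (forall y, y \in t ->
    exists2 x, subseq x t & y + \sum_(z <- x) z = 0 /\ ((size x).+1 < size t)%N) ->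
  (size w < size t)%N.
Proof.
move=> wP wt tt; apply: leq_trans (only_mzs_count wP wt) _.
rewrite -size_filter; apply: submset_size => y.
have [yt|yt] := boolP (y \in t); last first.
  by rewrite count_filter (eq_count (a2 := pred0)) ?count_pred0 // => z /=;
    case: eqP => // ->; rewrite (negPf yt).
have [x xt [yx xs]] := tt y yt.
apply: leq_trans (leq_count_subseq _ (filter_subseq _ _)) _.
rewrite leqNgt; apply/negP => ys.
have /submset_size : submset t (y :: x).
  apply: only_mzs_sub => //; last by rewrite big_cons.
  move=> z /=; have := leq_count_subseq (pred1 z) xt.
  have := only_mzs_submset z; have [<-|_] := eqVneq y z => zt xz.
    by apply: leq_trans ys.
  by rewrite add0n; apply: leq_trans zt.
by rewrite /= leqNgt xs.
Qed.

End Obstruction.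

(** The hypotheses of [only_mzs_size] for t = [vs] and w = [ws], together with the negation of its
    conclusion. *)
Definition obstruction ns vs ws :=
  let sums := map vsum (subseqs vs) in
  [&& mzsb ns vs, zsfreeb ns ws, size vs <= size ws,
    all (fun u => has (fun x => zerov ns (vadd (vsum u) x)) sums) (subseqs ws) &
    all (fun y => has (fun x => zerov ns (vadd y (vsum x)) &&
      ((size x).+1 < size vs)) (subseqs vs)) vs]%N.

Lemma obstructionP (G : finZmodType) ns (e : seq G) vs ws :
  coordinates ns e -> obstruction ns vs ws ->
  ~ minimal_wrt_davenport (minimal_zero_sum_sequences G).
Proof.
move=> eP /and5P[vsP wsP vws /allP wv /allP vv] /minimal_davenportP minG.
have tP := (mzsbP eP vs).1 vsP; have [s sD ts] := minG _ tP.
have : ~~ (size (map (ev e) ws) < size (map (ev e) vs))%N.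
  by rewrite !size_map -leqNgt.
move/negP; apply; apply: (only_mzs_size tP sD ts ((zsfreebP eP ws).1 wsP)).
  move=> u us; have [u' u'w ->] := subseq_map_ex us.
  have := wv u'; rewrite mem_subseqs u'w => /(_ isT)/hasP[_ /mapP[x xv ->] ux].
  exists (map (ev e) x); first by rewrite mem_subseqs in xv; apply: map_subseq.
  by rewrite !ev_vsum -ev_vadd; apply/eqP; rewrite eP.
move=> _ /mapP[y yv ->]; have /hasP[x xv /andP[yx xs]] := vv y yv.
exists (map (ev e) x); first by rewrite mem_subseqs in xv; apply: map_subseq.
split; last by rewrite !size_map.
by rewrite ev_vsum -ev_vadd; apply/eqP; rewrite eP.
Qed.

Lemma obstruction_Z4Z2 : obstruction [:: 4; 2]%N
  [:: [:: 1; 0]; [:: 1; 1]; [:: 0; 1]; [:: 2; 0]]%N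
  [:: [:: 1; 0]; [:: 1; 0]; [:: 1; 0]; [:: 0; 1]]%N.
Proof. by lazy. Qed.

(* Here and in the next lemma the minimal zero-sum sequence comes from a computer search. *)
Lemma obstruction_Z5Z5 : obstruction [:: 5; 5]%N
  [:: [:: 0; 1]; [:: 1; 0]; [:: 1; 1]; [:: 2; 2]; [:: 2; 4]; [:: 4; 2]]%N
  (nseq 4 [:: 1; 0] ++ nseq 4 [:: 0; 1])%N.
Proof. by lazy. Qed.

Lemma obstruction_Z3 : obstruction [:: 3; 3; 3; 3; 3]%N
  (unit_vecs 5 ++ [:: [:: 2; 1; 2; 0; 2]; [:: 1; 0; 1; 1; 0]; [:: 1; 2; 0; 1; 0];
    [:: 2; 2; 0; 1; 2]; [:: 2; 0; 2; 2; 1]])%N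
  (unit_vecs 5 ++ unit_vecs 5).
Proof. by lazy. Qed.

(** * Orders of elements and independent pairs *)

Section ElementOrders.

Variable G : finZmodType.
Implicit Types g h : G.
Local Notation minimal := (minimal_wrt_davenport (minimal_zero_sum_sequences G)).

Lemma mulrn_eq0_order g k : (g *+ k == 0) = (#[g]%g %| k)%N.
Proof. by rewrite order_dvdn FinRing.zmodXgE. Qed.

Lemma sum_nseq g k : \sum_(x <- nseq k g) x = g *+ k.
Proof. by elim: k => [|k IHk]; rewrite ?big_nil ?mulr0n //= big_cons IHk mulrS. Qed.

Lemma subseq_nseq g k u : subseq u (nseq k g) ->
  exists2 j, (j <= k)%N & u = nseq j g.
Proof.
move=> us; exists (size u); first by rewrite -[k](size_nseq k g) size_subseq.
by apply/all_pred1P/allP => x /(mem_subseq us)/nseqP[->] _; rewrite /= eqxx.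
Qed.

(* With [n = #[g]], the sequence [t = g^(n-5) (2g) (3g)] has all multiples of [g]
   as subsums, so [s] would need at least [n] terms in [{g, 2g, 3g}]; but the
   relations [2 (3g) = - (n-6) g], [3 (2g) = - (n-6) g], [3g = - (n-3) g] and
   [2 (2g) = - (n-4) g] only leave room for [n-1]. *)
Lemma minimal_order_lt6 g : minimal -> (#[g]%g < 6)%N.
Proof.
move=> /minimal_davenportP minG; rewrite ltnNge; apply/negP => n6.
set n := #[g]%g in n6.
pose T a b c := nseq a (g *+ 3) ++ nseq b (g *+ 2) ++ nseq c g.
pose t := T 1 1 (n - 5)%N.
have sumT a b c : \sum_(x <- T a b c) x = g *+ (3 * a + 2 * b + c).
  by rewrite !big_cat /= !sum_nseq -!mulrnA -!mulrnDr addnA.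
have sumT0 a b c : \sum_(x <- T a b c) x = 0 <-> (n %| 3 * a + 2 * b + c)%N.
  by rewrite sumT -mulrn_eq0_order; split=> /eqP.
have subT a b c u : subseq u (T a b c) ->
    exists a' b' c', [/\ u = T a' b' c', (a' <= a)%N, (b' <= b)%N & (c' <= c)%N].
  move=> /subseq_cat_ex[u1 [u' [-> /subseq_nseq[a' a'P ->]]]].
  move=> /subseq_cat_ex[u2 [u3 [-> /subseq_nseq[b' b'P ->]]]].
  by move=> /subseq_nseq[c' c'P ->]; exists a', b', c'.
have Tsub a b c a' b' c' : (a' <= a)%N -> (b' <= b)%N -> (c' <= c)%N ->
    subseq (T a' b' c') (T a b c).
  have nseqS k k' (x : G) : (k' <= k)%N -> subseq (nseq k' x) (nseq k x).
    by move=> /subnKC <-; rewrite nseqD prefix_subseq.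
  by move=> ? ? ?; rewrite !cat_subseq ?nseqS.
have mul_neq i j : (i < j < n)%N -> (g *+ i == g *+ j) = false.
  move=> /andP[ij jn]; rewrite -!FinRing.zmodXgE eq_expg_mod_order.
  by rewrite !modn_small ?(ltn_trans ij) // (ltn_eqF ij).
have n12 : (g == g *+ 2) = false by rewrite (mul_neq 1%N 2%N) // (leq_trans _ n6).
have n13 : (g == g *+ 3) = false by rewrite (mul_neq 1%N 3%N) // (leq_trans _ n6).
have n23 : (g *+ 2 == g *+ 3) = false by rewrite mul_neq // (leq_trans _ n6).
have countT a b c y : count_mem y (T a b c) =
    ((g *+ 3 == y) * a + ((g *+ 2 == y) * b + (g == y) * c))%N.
  by rewrite !count_cat !count_nseq.
have tP : mzs t.
  split=> //; first by rewrite sumT0; apply/dvdnP; exists 1%N; lia.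
  move=> u /subT[a [b [c [-> a1 b1 cn]]]]; rewrite sumT0 => /dvdnP[[|k] E].
    have [-> [-> ->]] : a = 0%N /\ b = 0%N /\ c = 0%N by lia.
    by left.
  have [-> [-> ->]] : a = 1%N /\ b = 1%N /\ c = (n - 5)%N.
    have : (n <= k.+1 * n)%N by rewrite leq_pmull.
    by move: E; move: (k.+1 * n)%N => m; lia.
  by right.
have [s sD ts] := minG t tP.
have wP : zsfree (nseq n.-1 g).
  move=> u /subseq_nseq[[|j] jn ->] //; rewrite sum_nseq => /eqP.
  by rewrite mulrn_eq0_order => /dvdn_leq - /(_ isT); rewrite -/n; lia.
have tsub := only_mzs_submset sD ts.
(* Any sequence with formal total [n] that fits into [s] is zero-sum, hence contains [t]. *)
have sT a b c : (a <= count_mem (g *+ 3) s)%N -> (b <= count_mem (g *+ 2) s)%N ->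
    (c <= count_mem g s)%N -> (3 * a + 2 * b + c = n)%N ->
    [/\ 0 < a, 0 < b & n - 5 <= c]%N.
  move=> aP bP cP abc.
  have : submset t (T a b c).
    apply: (only_mzs_sub ts).
    - move=> y; rewrite countT.
      have [<-|_] := eqVneq (g *+ 3) y.
        by rewrite n23 n13 !mul0n !addn0 mul1n.
      have [<-|_] := eqVneq (g *+ 2) y; first by rewrite n12 !mul0n addn0 mul1n.
      by have [<-|_] := eqVneq g y; rewrite ?mul1n.
    - by move=> /(congr1 size); rewrite !size_cat !size_nseq /=; lia.
    by rewrite sumT0 abc.
  move=> tT; have := tT (g *+ 3); have := tT (g *+ 2); have := tT g.
  rewrite !countT !eqxx n12 n13 n23 ![_ *+ 3 == _]eq_sym n13 n23 [_ *+ 2 == _]eq_sym n12.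
  by rewrite !mul1n !mul0n; split; lia.
have := only_mzs_count tP sD ts wP.
rewrite size_nseq ltnNge => /(_ _)/negP; apply.
  move=> u /subseq_nseq[j jn ->].
  (* Write n - j as a subsum of [t]: copies of [g] suffice for j >= 5, while for j = 1, 2, 3, 4 it
     is 3 + 2 + (n-6), 3 + (n-5), 2 + (n-5), 2 + (n-6). *)
  have [a [b [c [a1 b1 cn jabc]]]] : exists a b c,
      [/\ a <= 1, b <= 1, c <= n - 5 & n %| j + (3 * a + 2 * b + c)]%N.
    have [->|j0] := posnP j; first by exists 0%N, 0%N, 0%N.
    have q a b c : (j + (3 * a + 2 * b + c) = n)%N ->
        (n %| j + (3 * a + 2 * b + c))%N by move=> ->.
    have [j5|] := leqP 5 j; first by exists 0%N, 0%N, (n - j)%N; split=> //; [|apply: q]; lia.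
    case: j j0 jn q => [//|[|[|[|[|//]]]]] _ _ q _.
    - by exists 1%N, 1%N, (n - 6)%N; split=> //; [|apply: q]; lia.
    - by exists 1%N, 0%N, (n - 5)%N; split=> //; apply: q; lia.
    - by exists 0%N, 1%N, (n - 5)%N; split=> //; apply: q; lia.
    by exists 0%N, 1%N, (n - 6)%N; split=> //; [|apply: q]; lia.
  exists (T a b c); first exact: Tsub.
  by rewrite sum_nseq sumT -mulrnDr; apply/eqP; rewrite mulrn_eq0_order.
have cU (P Q : pred G) : (count (predU P Q) s <= count P s + count Q s)%N.
  by rewrite -count_predUI leq_addr.
have ct : (count (mem t) s <=
    count_mem (g *+ 3) s + (count_mem (g *+ 2) s + count_mem g s))%N.
  apply: leq_trans (leq_trans (cU _ _) (leq_add (leqnn _) (cU _ _))).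
  apply: sub_count => y /=; rewrite !mem_cat => /or3P[] /nseqP[-> _];
    by rewrite eqxx ?orbT.
have := tsub (g *+ 3); have := tsub (g *+ 2); have := tsub g.
rewrite !countT !eqxx n12 n13 n23 ![_ *+ 3 == _]eq_sym n13 n23 [_ *+ 2 == _]eq_sym n12.
rewrite !mul1n !mul0n !add0n !addn0.
move: ct sT; move: (count (mem t) s) (count_mem g s) (count_mem (g *+ 2) s)
  (count_mem (g *+ 3) s) => X A B C XABC sT An Bn Cn.
have C1 : (C <= 1)%N.
  rewrite leqNgt; apply/negP => C2.
  by have [||||//] := sT 2 0 (n - 6)%N; lia.
have B2 : (B <= 2)%N.
  rewrite leqNgt; apply/negP => B3.
  by have [||||//] := sT 0 3 (n - 6)%N; lia.
have A4 : (A <= n - 4)%N.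
  rewrite leqNgt; apply/negP => A3.
  by have [||||_ //] := sT 1 0 (n - 3)%N; lia.
have AB : ~ (2 <= B /\ n - 4 <= A)%N.
  by case=> B2' A4'; have [||||//] := sT 0 2 (n - 4)%N; lia.
lia.
Qed.

(** A subgroup of prime order not contained in the cyclic group of [g] meets it trivially. *)
Lemma coordinates_pair g h p : prime p -> #[h]%g = p -> h \notin <[g]>%g ->
  coordinates [:: #[g]%g; p] [:: g; h].
Proof.
move=> p_pr hp hg [|k [|l v]] /=; rewrite ?eqxx ?addr0 ?andbT ?mulrn_eq0_order //.
have [pl|pl] := boolP (p %| l)%N.
  by rewrite -hp -mulrn_eq0_order in pl; rewrite (eqP pl) addr0 mulrn_eq0_order andbT.
rewrite andbF; apply/negP => /eqP ghkl; move/negP: pl; apply.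
have TI : <[h]>%g :&: <[g]>%g = 1%g.
  by apply: prime_TIg; rewrite ?cycle_subG // -orderE hp.
have : h *+ l \in <[h]>%g :&: <[g]>%g.
  rewrite inE -{1}FinRing.zmodXgE mem_cycle /=.
  have -> : h *+ l = - (g *+ k) by apply/eqP; rewrite -addr_eq0 addrC ghkl.
  by rewrite -FinRing.zmodVgE groupV -FinRing.zmodXgE mem_cycle.
by rewrite TI -hp -mulrn_eq0_order => /set1P ->.
Qed.

End ElementOrders.

Lemma coordinates_delta p r (I : seq 'I_r) : prime p -> uniq I ->
  coordinates (nseq (size I) p) [seq (delta_mx 0 i : 'rV['F_p]_r) | i <- I].
Proof.
move=> p_pr; elim: I => [|i I IHI] /=; first by move=> _ v; rewrite /= eqxx.
case/andP=> iI /IHI{}IHI [|k v] /=; first by rewrite eqxx.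
have evi : (ev [seq (delta_mx 0 i : 'rV['F_p]_r) | i <- I] v) 0 i = 0.
  elim: I v iI {IHI} => [|j I IHI] [|l v] /=; rewrite ?mxE //.
  rewrite inE negb_or => /andP[ij iI]; rewrite IHI // addr0 mulmxnE mxE eqxx (negPf ij).
  by rewrite mul0rn.
rewrite -IHI -Fp_nat_eq0 //; apply/eqP/andP => [E|[/eqP k0 /eqP ->]].
  have k0 : k%:R = 0 :> 'F_p.
    by move/rowP/(_ i): E; rewrite mxE evi addr0 mulmxnE !mxE !eqxx.
  split; first by rewrite k0.
  by move: E; rewrite -scaler_nat k0 scale0r add0r => ->.
by rewrite addr0 -scaler_nat k0 scale0r.
Qed.

Lemma coordinates_inj (G H : zmodType) (f : G -> H) ns e :
  {morph f : x y / x + y} -> injective f -> coordinates ns (map f e) -> coordinates ns e.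
Proof.
move=> fD f_inj eP v; rewrite -eP.
have f0 : f 0 = 0 := morph_add0 fD.
have fM x k : f (x *+ k) = f x *+ k.
  by elim: k => [|k IHk]; rewrite ?mulr0n // !mulrS fD IHk.
have -> : ev (map f e) v = f (ev e v).
  elim: e v {eP} => [|x e IHe] [|k v]; rewrite ?f0 //=.
  by rewrite IHe fD fM.
by rewrite -(inj_eq f_inj) f0.
Qed.

(** * Determination of the groups with minimal A(G) *)

Section Classification.

Variable G : finZmodType.
Hypothesis G0 : exists x : G, x <> 0.
Local Notation minimal := (minimal_wrt_davenport (minimal_zero_sum_sequences G)).

Lemma abelem_zmod (H : finZmodType) p : prime p ->
  (forall x : H, x *+ p = 0) -> (p.-abelem [set: H])%g.
Proof.
move=> p_pr Hp; rewrite abelemE // FinRing.zmod_abelian /=.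
by apply/exponentP => x _; rewrite FinRing.zmodXgE Hp.
Qed.

Lemma isog_rV p : prime p -> (forall x : G, x *+ p = 0) ->
  exists2 r, (0 < r)%N & [set: G] \isog [set: 'rV['F_p]_r].
Proof.
move=> p_pr Gp; have Gab := abelem_zmod p_pr Gp.
have cG := card_pgroup (abelem_pgroup Gab).
exists (logn p #|[set: G]|).
  rewrite lt0n; apply/eqP => r0; case: G0 => x; apply.
  move: cG; rewrite r0 expn0 => /eqP; rewrite -trivg_card1 => /eqP/setP/(_ x).
  by rewrite !inE => /esym/eqP.
rewrite (isog_abelem_card _ Gab) abelem_zmod //=.
  by rewrite [X in _ == X]cG cardsT card_mx mul1n card_Fp.
by move=> x; rewrite -scaler_nat (eqP (_ : p%:R == 0)) ?scale0r // Fp_nat_eq0.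
Qed.

Lemma isog_Zp (g : G) p : (1 < p)%N -> #[g]%g = p -> (forall h, h \in <[g]>%g) ->
  [set: G] \isog [set: 'Z_p].
Proof.
move=> p1 gp gG.
have -> : [set: G] = <[g]>%g by apply/setP => h; rewrite inE gG.
rewrite isog_cyclic_card ?cycle_cyclic //; apply/andP; split.
  by apply/cyclicP; exists Zp1; rewrite -Zp_cycle.
by rewrite cardsT card_ord Zp_cast // -orderE gp.
Qed.

Lemma coprime_order_add (g h : G) : coprime #[g]%g #[h]%g ->
  #[(g + h)%R]%g = (#[g]%g * #[h]%g)%N.
Proof.
move=> co; rewrite -FinRing.zmodMgE orderM //.
exact: FinRing.zmod_mulgC.
Qed.

Hypothesis minG : minimal.

Lemma minimal_coprime_orders (g h : G) :
  coprime #[g]%g #[h]%g -> (#[g]%g * #[h]%g < 6)%N.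
Proof. by move=> /coprime_order_add <-; apply: minimal_order_lt6. Qed.

(** The obstruction in Z_4 + Z_2 puts all involutions into the group of [g]. For any [h], the
    involution or zero 2h is then an even multiple 2mg, and h - mg is again killed by 2; so [h] lies
    in that group. *)
Lemma minimal_isog_Z4 (g : G) : #[g]%g = 4 -> [set: G] \isog [set: 'Z_4].
Proof.
move=> g4; apply: (isog_Zp _ g4) => // h; apply: contraT => hg; exfalso.
have no2 f : #[f]%g = 2 -> f \in <[g]>%g.
  move=> f2; apply: contraT => fg.
  have := coordinates_pair (isT : prime 2) f2 fg; rewrite g4 => eP.
  by have := obstructionP eP obstruction_Z4Z2.
have h4 : (h *+ 2) *+ 2 = 0.
  rewrite -mulrnA; apply/eqP; rewrite mulrn_eq0_order.
  have := minimal_order_lt6 h minG; have := minimal_coprime_orders (g := g) (h := h).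
  have := order_gt0 h; rewrite g4.
  by move: #[h]%g => [|[|[|[|[|[|//]]]]]] //= _ /(_ isT).
have order2 (x : G) : x *+ 2 = 0 -> x \in <[g]>%g.
  move=> x2; have [->|x0] := eqVneq x 0; first exact: group1.
  by apply: no2; apply: nt_prime_order.
have /cycleP[k hk] := order2 _ h4; rewrite FinRing.zmodXgE in hk.
have k2 : (2 %| k)%N.
  have : (#[g]%g %| k * 2)%N by rewrite -mulrn_eq0_order mulrnA -hk h4.
  by rewrite g4 (@dvdn_pmul2r 2 2).
have : h - g *+ (k %/ 2) \in <[g]>%g.
  apply: order2; rewrite mulrnBl -mulrnA divnK // hk subrr //.
rewrite -FinRing.zmodVgE -FinRing.zmodXgE -FinRing.zmodMgE groupMr ?groupV ?mem_cycle //.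
by move/negP: hg.
Qed.

(** Coprime orders multiply and stay below 6, so nonzero elements have order 5; one outside the
    group of [g] would give a copy of Z_5^2. *)
Lemma minimal_isog_Z5 (g : G) : #[g]%g = 5 -> [set: G] \isog [set: 'Z_5].
Proof.
move=> g5; apply: (isog_Zp _ g5) => // h; apply: contraT => hg; exfalso.
have h5 : #[h]%g = 5.
  have h1 : #[h]%g != 1%N.
    by rewrite order_eq1; apply: contraNneq hg => ->; apply: group1.
  have := minimal_order_lt6 h minG; have := minimal_coprime_orders (g := g) (h := h).
  have := order_gt0 h; move: h1; rewrite g5.
  by move: #[h]%g => [|[|[|[|[|[|//]]]]]] //= _ _ /(_ isT).
have := coordinates_pair (isT : prime 5) h5 hg; rewrite g5 => eP.
by have := obstructionP eP obstruction_Z5Z5.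
Qed.

(** Five unit vectors, pulled back to [G], are independent of order 3 and carry the obstruction in
    Z_3^5. *)
Lemma minimal_rV3 r : [set: G] \isog [set: 'rV['F_3]_r] -> (r <= 4)%N.
Proof.
move=> /isog_zmodP[f [fD [f' fK f'K]]]; rewrite leqNgt; apply/negP => r5.
pose I := take 5 (enum 'I_r).
have sI : size I = 5 by rewrite size_takel // size_enum_ord.
have uI : uniq I by rewrite take_uniq // enum_uniq.
have := coordinates_delta (isT : prime 3) uI; rewrite sI => eP.
set e := (map _ _) in eP.
have eP' : coordinates (nseq 5 3) (map f' e).
  apply: (coordinates_inj fD (can_inj fK)).
  by rewrite (mapK f'K).
by have := obstructionP eP' obstruction_Z3.
Qed.

End Classification.

Local Close Scope ring_scope.

Theorem theorem3p6 (G : finZmodType) (hG : exists x : G, x <> 0%R) :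
  minimal_wrt_davenport (minimal_zero_sum_sequences G) <->
  [\/ exists r : nat, 1 <= r /\ [set: G] \isog [set: 'rV['Z_2]_r],
      exists r : nat, 1 <= r <= 4 /\ [set: G] \isog [set: 'rV['Z_3]_r]
    | [set: G] \isog [set: 'Z_4] \/ [set: G] \isog [set: 'Z_5] ].
Proof.
split=> [minG|]; last first.
  case=> [[r [r1 Gr]]|[r [/andP[r1 r4] Gr]]|[G4|G5]].
  - have [f [fD [f' fK f'K]]] := isog_zmodP Gr.
    apply: (minimal_davenport (d := r.+1)) => //.
      apply: (zs_bounded_inj fD (can_inj fK)).
      by have := @zs_bounded_rV 2 r isT; rewrite muln1.
    by apply: (zs_extendable_bij fD (can_inj fK) f'K); apply: zs_extendable_F2.
  - have [f [fD [f' fK f'K]]] := isog_zmodP Gr.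
    apply: (minimal_davenport (d := (r * 2).+1)) => //.
      by apply: (zs_bounded_inj fD (can_inj fK)); apply: (@zs_bounded_rV 3 r isT).
    by apply: (zs_extendable_bij fD (can_inj fK) f'K); apply: zs_extendable_F3.
  - have [f [fD [f' fK f'K]]] := isog_zmodP G4; have /andP[b4 e4] := cyclic4.
    apply: (minimal_davenport (d := 4)) => //.
      by apply: (zs_bounded_inj fD (can_inj fK)); apply: zs_bounded_Zp.
    by apply: (zs_extendable_bij fD (can_inj fK) f'K); apply: zs_extendable_Zp.
  have [f [fD [f' fK f'K]]] := isog_zmodP G5; have /andP[b5 e5] := cyclic5.
  apply: (minimal_davenport (d := 5)) => //.
    by apply: (zs_bounded_inj fD (can_inj fK)); apply: zs_bounded_Zp.
  by apply: (zs_extendable_bij fD (can_inj fK) f'K); apply: zs_extendable_Zp.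
(* All orders are at most 5. Without elements of order 4 or 5, orders 2 and 3 cannot both occur, so
   [G] is elementary abelian. *)
have [[g g4]|no4] := pselect (exists g : G, #[g]%g = 4).
  by constructor 3; left; apply: minimal_isog_Z4 g4.
have [[g g5]|no5] := pselect (exists g : G, #[g]%g = 5).
  by constructor 3; right; apply: minimal_isog_Z5 g5.
have o123 (x : G) : [\/ #[x]%g = 1%N, #[x]%g = 2 | #[x]%g = 3].
  have := minimal_order_lt6 x minG; have := order_gt0 x.
  have : #[x]%g <> 4 by move=> x4; apply: no4; exists x.
  have : #[x]%g <> 5 by move=> x5; apply: no5; exists x.
  move: #[x]%g => [|[|[|[|[|[|//]]]]]] //= _ _ _ _;
    by [constructor 1|constructor 2|constructor 3].
have [[g g3]|no3] := pselect (exists g : G, #[g]%g = 3).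
  have G3 (x : G) : (x *+ 3 = 0)%R.
    apply/eqP; rewrite mulrn_eq0_order; case: (o123 x) => ox; rewrite ox //.
    by have := @minimal_coprime_orders _ minG g x; rewrite g3 ox => /(_ isT).
  have [r r0 Gr] := isog_rV hG (isT : prime 3) G3.
  constructor 2; exists r; rewrite r0; split=> //.
  exact: minimal_rV3 Gr.
have G2 (x : G) : (x *+ 2 = 0)%R.
  apply/eqP; rewrite mulrn_eq0_order; case: (o123 x) => ox; rewrite ?ox //.
  by case: no3; exists x.
have [r r0 Gr] := isog_rV hG (isT : prime 2) G2.
by constructor 1; exists r.
Qed.
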